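(* Let $n\ge 2$ and let $A=\Bbbk\langle x_1,\dots,x_n\rangle/(x_jx_i-q_{ij}x_ix_j)_{1\le i,j\le n}$ be a skew polynomial algebra of dimension $n$, where $\deg x_i=1$ and $(q_{ij})\in\mathbb M_n(\Bbbk)$ has all entries nonzero with $q_{ii}=1$ and $q_{ji}=q_{ij}^{-1}$. Then $A$ satisfies the point-exact condition.
   Context: $\Bbbk$ is an algebraically closed field of characteristic $0$. Skew polynomial algebras are Koszul: a connected graded algebra $A$ is Koszul if the right module $\Bbbk_A=A/A_{\ge1}$ has a linear resolution, i.e. a graded projective resolution whose $i$-th term is generated in degree $i$. A Koszul algebra is quadratic: $A=T(V)/(R)=\Bbbk\langle x_1,\dots,x_n\rangle/(f_1,\dots,f_r)$, where $V=A_1$ has basis $x_1,\dots,x_n$ and $R\subset V^{\otimes2}$ has basis $f_1,\dots,f_r$. Write $f_i=\sum_j x_jf_{ji}=\sum_j g_{ij}x_j$ with $f_{ji},g_{ij}\in V$. The right module $\Bbbk_A$ has a linear resolution $P_\bullet$ with $P_i=A(-i)^{\oplus s_i}$ and differentials $d_i:P_i\to P_{i-1}$ given by matrices over $V$ ($s_0=1$, $s_1=n$, $s_2=r$, $d_1=(x_1,\dots,x_n)$, $d_2=(f_{ji})_{j,i}\in\mathbb M_{n\times r}(V)$). The left module ${}_A\Bbbk$ has a linear resolution $Q_\bullet$ with $Q_i=A(-i)^{\oplus s_i}$ and differentials $h_i$ given by matrices over $V$ ($h_1=(x_1,\dots,x_n)^t$, $h_2=(g_{ij})\in\mathbb M_{r\times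 n}(V)$, with $h_{i+1}h_i=0$ over $A$). For a matrix $M$ over $V$ and $p=(p_1:\cdots:p_n)\in\mathbb P(V^* )=\mathbb P^{n-1}$, $M_p$ is the matrix over $\Bbbk$ (up to scalar) obtained by substituting $x_i\mapsto p_i$. Define $$X_A=\{p:\operatorname{rank}_\Bbbk(d_2)_p<n\},\qquad {}_AX=\{p:\operatorname{rank}_\Bbbk(h_2)_p<n\}.$$ These and the notions below are independent of choices of linear resolutions. $A$ is right point-exact at degree $i\ge1$ if $\operatorname{rank}_\Bbbk(d_i)_p+\operatorname{rank}_\Bbbk(d_{i+1})_p=s_i$ for all $p\in X_A$; left point-exact at degree $i$ if $\operatorname{rank}_\Bbbk(h_i)_p+\operatorname{rank}_\Bbbk(h_{i+1})_p=s_i$ for all $p\in{}_AX$. $A$ satisfies the point-exact condition if it is both right and left point-exact at every degree $i\ge1$. *)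

(* Defs.v *)
From HB Require Import structures.
From mathcomp Require Import all_boot all_order all_algebra.
From mathcomp Require Import generic_quotient ring_quotient.
From mathcomp Require Import boolp.
From mathcomp.multinomials Require Import monalg.

Set Implicit Arguments.
Unset Strict Implicit.
Unset Printing Implicit Defensive.

Import GRing.Theory.

Local Open Scope ring_scope.
Local Open Scope quotient_scope.

(* Free associative algebra k<x_0, ..., x_(n-1)> *)
Notation free_alg k n := {malg k[{fmonom 'I_n}]}.

Section FreeAlgebra.
Variables (k : fieldType) (n : nat).

Definition gen (i : 'I_n) : free_alg k n := << fmu i >>.

(* The row vector v stands for the linear form \sum_i v_i x_i in V. *)
Definition linform (v : 'rV[k]_n) : free_alg k n := \sum_i v 0 i *: gen i.

(* The matrix f stands for the tensor \sum_(i, j) f_ij x_i x_j in V (x) V. *)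
Definition quadform (f : 'M[k]_n) : free_alg k n :=
  \sum_i \sum_j f i j *: (gen i * gen j).

Lemma quadform_const f : (quadform f)@_mone = 0.
Proof.
have g0 i : (gen i)@_mone = 0.
  by rewrite mcoeffU; case: eqP => // /eqP; rewrite fm1_eq1.
rewrite raddf_sum big1// => i _; rewrite raddf_sum big1// => j _ /=.
by rewrite mcoeffZ rmorphM /= g0 mul0r mulr0.
Qed.

End FreeAlgebra.

Section QuadraticAlgebra.
Variables (k : fieldType) (n : nat) (R : {vspace 'M[k]_n}).
Local Notation F := (free_alg k n).

(* Two-sided ideal (R) of the free algebra *)
Definition rel_ideal : {pred F} := fun f =>
  `[< exists2 s : seq (F * 'M[k]_n * F),
        all (fun t => t.1.2 \in R) s &
        f = \sum_(t <- s) t.1.1 * quadform t.1.2 * t.2 >].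

Lemma rel_idealMl a f : f \in rel_ideal -> a * f \in rel_ideal.
Proof.
move=> /asboolP [s sR ->]; apply/asboolP.
exists [seq (a * t.1.1, t.1.2, t.2) | t <- s]; first by rewrite all_map.
by rewrite mulr_sumr big_map; apply: eq_bigr => t _; rewrite /= !mulrA.
Qed.

Lemma rel_idealMr a f : f \in rel_ideal -> f * a \in rel_ideal.
Proof.
move=> /asboolP [s sR ->]; apply/asboolP.
exists [seq (t.1.1, t.1.2, t.2 * a) | t <- s]; first by rewrite all_map.
by rewrite mulr_suml big_map; apply: eq_bigr => t _; rewrite /= !mulrA.
Qed.

Lemma rel_ideal_zmod_closed : zmod_closed rel_ideal.
Proof.
split; first by apply/asboolP; exists [::]; rewrite ?big_nil.
move=> f g fI gI.
have {gI} : -1 * g \in rel_ideal by apply: rel_idealMl.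
rewrite mulN1r; move: (- g) fI => {}g.
move=> /asboolP [s sR ->] /asboolP [s' sR' ->].
by apply/asboolP; exists (s ++ s'); rewrite ?all_cat ?sR ?big_cat.
Qed.

HB.instance Definition _ :=
  GRing.isZmodClosed.Build F rel_ideal rel_ideal_zmod_closed.

Lemma rel_ideal1 : (1 : F) \notin rel_ideal.
Proof.
apply/negP => /asboolP [s _ /(congr1 (mcoeff mone))].
rewrite rmorph1 raddf_sum big1 => [/eqP|t _]; first by rewrite oner_eq0.
by rewrite /= !rmorphM /= quadform_const mulr0 mul0r.
Qed.

(* A = T(V)/(R); ring_quotient equips {quot _} with a ring structure only in
   the commutative case, so the multiplication is defined here. *)
Definition quad_alg : Type := @Quotient.quot F rel_ideal.
HB.instance Definition _ := Choice.on quad_alg.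
HB.instance Definition _ := ZmodQuotient.on quad_alg.
Local Notation A := quad_alg.

Definition qone : A := lift_cst A 1.
Definition qmul := lift_op2 A *%R.

Canonical pi_qone_morph := PiConst qone.

Lemma pi_qmul : {morph \pi_A : x y / x * y >-> qmul x y}.
Proof.
move=> x y; unlock qmul; apply/eqP; rewrite -Quotient.idealrBE.
rewrite -[_ * _](addrNK (x * repr (\pi_A y))) -mulrBr -addrA -mulrBl rpredD //.
  by rewrite rel_idealMl // Quotient.idealrBE reprK.
by rewrite rel_idealMr // Quotient.idealrBE reprK.
Qed.
Canonical pi_qmul_morph := PiMorph2 pi_qmul.

Lemma qmulA : associative qmul.
Proof. by move=> x y z; rewrite -[x]reprK -[y]reprK -[z]reprK !piE mulrA. Qed.

Lemma qmul1 : left_id qone qmul.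
Proof. by move=> x; rewrite -[x]reprK !piE mul1r. Qed.

Lemma qmulr1 : right_id qone qmul.
Proof. by move=> x; rewrite -[x]reprK !piE mulr1. Qed.

Lemma qmulDl : left_distributive qmul +%R.
Proof.
by move=> x y z; rewrite -[x]reprK -[y]reprK -[z]reprK !piE mulrDl.
Qed.

Lemma qmulDr : right_distributive qmul +%R.
Proof.
by move=> x y z; rewrite -[x]reprK -[y]reprK -[z]reprK !piE mulrDr.
Qed.

Lemma qone_neq0 : qone != 0.
Proof. by rewrite piE Quotient.equivE subr0 rel_ideal1. Qed.

HB.instance Definition _ := GRing.Zmodule_isNzRing.Build A
  qmulA qmul1 qmulr1 qmulDl qmulDr qone_neq0.
HB.instance Definition _ := @isNzRingQuotient.Build
  F (Quotient.equiv rel_ideal) 0 -%R +%R 1%R *%R A (lock _) pi_qmul.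

End QuadraticAlgebra.

Section PointExact.
Variables (k : fieldType) (n : nat) (R : {vspace 'M[k]_n}).
Local Notation A := (quad_alg R).

(* The ideal A_{>=1}: classes of elements without constant term. *)
Definition irrelevant (a : A) : Prop :=
  exists2 f : free_alg k n, f@_mone = 0 & a = \pi_A f.

(* A matrix over V, seen as a matrix over A. *)
Definition mxA s t (M : 'M['rV[k]_n]_(s, t)) : 'M[A]_(s, t) :=
  map_mx (fun v => \pi_A (linform v)) M.

(* M_p: evaluation of a matrix of linear forms at a representative p of a
   point of P(V^* ) *)
Definition mxeval s t (M : 'M['rV[k]_n]_(s, t)) (p : 'rV[k]_n) : 'M[k]_(s, t) :=
  map_mx (fun v : 'rV[k]_n => \sum_i v 0 i * p 0 i) M.

(* Linear resolution of the right module A/A_{>=1}: the right module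
   P_i = A(-i)^(s i) consists of column vectors and d_i : P_i -> P_(i-1) is left
   multiplication by the matrix d i. Since s 0.-1 = s 0, there is a component
   d 0, which plays no role. As the entries of d i are in V = A_1, the complex
   is graded, and it is exact as a graded complex iff it is exact. *)
Record right_linear_resolution (s : nat -> nat)
    (d : forall i, 'M['rV[k]_n]_(s i.-1, s i)) : Prop := {
  rres_rank0 : s 0%N = 1%N;
  rres_aug : forall u : 'cV[A]_(s 0%N),
    (exists w : 'cV[A]_(s 1%N), u = mxA (d 1%N) *m w) <->
    (forall j, irrelevant (u j 0));
  rres_exact : forall i (u : 'cV[A]_(s i.+1)),
    mxA (d i.+1) *m u = 0 <->
    exists w : 'cV[A]_(s i.+2), u = mxA (d i.+2) *m w }.

(* Left-hand version: Q_i = A(-i)^(s i) consists of row vectors and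
   h_i : Q_i -> Q_(i-1) is right multiplication by the matrix h i. *)
Record left_linear_resolution (s : nat -> nat)
    (h : forall i, 'M['rV[k]_n]_(s i, s i.-1)) : Prop := {
  lres_rank0 : s 0%N = 1%N;
  lres_aug : forall u : 'rV[A]_(s 0%N),
    (exists w : 'rV[A]_(s 1%N), u = w *m mxA (h 1%N)) <->
    (forall j, irrelevant (u 0 j));
  lres_exact : forall i (u : 'rV[A]_(s i.+1)),
    u *m mxA (h i.+1) = 0 <->
    exists w : 'rV[A]_(s i.+2), u = w *m mxA (h i.+2) }.

Definition right_koszul : Prop := exists s d, @right_linear_resolution s d.
Definition left_koszul : Prop := exists s h, @left_linear_resolution s h.

(* With f_l = \sum_(j, m) F_jm x_j x_m running through a basis of R, one has
   f_l = \sum_j x_j f_jl for f_jl = \sum_m F_jm x_m, and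
   f_l = \sum_j g_lj x_j for g_lj = \sum_m F_mj x_m. *)
Definition right_relmx : 'M['rV[k]_n]_(n, \dim R) :=
  \matrix_(j, l) row j (vbasis R)`_l.
Definition left_relmx : 'M['rV[k]_n]_(\dim R, n) :=
  \matrix_(l, j) (col j (vbasis R)`_l)^T.

(* X_A and _A X, as sets of representatives p != 0 *)
Definition right_points (p : 'rV[k]_n) : Prop :=
  p != 0 /\ (\rank (mxeval right_relmx p) < n)%N.
Definition left_points (p : 'rV[k]_n) : Prop :=
  p != 0 /\ (\rank (mxeval left_relmx p) < n)%N.

Definition right_point_exact (i : nat) : Prop :=
  forall s d, @right_linear_resolution s d ->
  forall p, right_points p ->
    (\rank (mxeval (d i) p) + \rank (mxeval (d i.+1) p))%N = s i.

Definition left_point_exact (i : nat) : Prop :=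
  forall s h, @left_linear_resolution s h ->
  forall p, left_points p ->
    (\rank (mxeval (h i) p) + \rank (mxeval (h i.+1) p))%N = s i.

(* Koszulness is included because right_point_exact and left_point_exact
   quantify over all linear resolutions. *)
Definition point_exact_condition : Prop :=
  [/\ right_koszul, left_koszul &
      forall i, (0 < i)%N -> right_point_exact i /\ left_point_exact i].

End PointExact.

(* Span of the relations x_j x_i - q_ij x_i x_j *)
Definition skew_relations (k : fieldType) (n : nat) (q : 'M[k]_n) :
    {vspace 'M[k]_n} :=
  (\sum_(i < n) \sum_(j < n)
     <[delta_mx j i - q i j *: delta_mx i j : 'M[k]_n]>)%VS.

(* Main.v *)
From HB Require Import structures.
Require Import Defs.
From mathcomp Require Import all_boot all_order all_algebra.
From mathcomp Require Import generic_quotient ring_quotient finmap ring boolp.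
From mathcomp.multinomials Require Import monalg.

Set Implicit Arguments.
Unset Strict Implicit.
Unset Printing Implicit Defensive.

Import GRing.Theory.

Local Open Scope ring_scope.
Local Open Scope quotient_scope.

(* Choose a matrix a with a_ij = q_ij a_ji. The algebra A then has a basis x^m
   (m in N^n) with x_j x^m = (prod_i a_ij^m_i) x^(m + e_j), so that column
   vectors over A become finitely supported functions on N^n and a matrix of
   linear forms acts on them by weighted shifts. Left modules lead to the same
   picture with a replaced by its transpose, so both sides are treated at once.

   Two linear resolutions differ by invertible scalar matrices, because the
   columns of d_(i+1) form a basis of the linear syzygies of d_i; hence ranks
   at points may be computed on the Koszul resolution. That one is exact since,
   in each multidegree, it is up to nonzero scalars the complex of a simplex.

   A point p of X_A comes with a second point y such that
   a_lj y_l p_j = a_jl y_j p_l. The Koszul differentials K_i satisfy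
   K_i(y) K_(i+1)(p) = 0, while a submatrix with a nonzero diagonal gives
   rank K_(i+1) >= C(n-1, i) at both y and p. Since K_i has C(n, i) columns,
   both bounds are attained, and Pascal's rule gives point-exactness. *)

(** * Exponent vectors of monomials *)

Notation mon n := {ffun 'I_n -> nat}.

Section Monomials.
Variable n : nat.
Implicit Types (m : mon n) (i j : 'I_n).

Definition mon0 : mon n := [ffun=> 0%N].
Definition inc m j : mon n := [ffun i => (m i + (i == j))%N].
Definition dec m j : mon n := [ffun i => (m i - (i == j))%N].
Definition mon1 j : mon n := inc mon0 j.

Lemma incK m j : dec (inc m j) j = m.
Proof. by apply/ffunP => i; rewrite !ffunE addnK. Qed.

Lemma decK m j : (0 < m j)%N -> inc (dec m j) j = m.
Proof.
move=> mj; apply/ffunP => i; rewrite !ffunE.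
by case: eqP => [->|_]; rewrite ?subnK // subn0 addn0.
Qed.

Lemma decC m i j : dec (dec m i) j = dec (dec m j) i.
Proof. by apply/ffunP => l; rewrite !ffunE subnAC. Qed.

Lemma incj_gt0 m j : (0 < inc m j j)%N.
Proof. by rewrite ffunE eqxx addn1. Qed.

Lemma mon1_inj : injective mon1.
Proof.
move=> i j /ffunP/(_ i); rewrite !ffunE eqxx.
by case: (i == j) / eqP.
Qed.

Lemma dec_eq0 m j : (0 < m j)%N -> (dec m j == mon0) = (m == mon1 j).
Proof.
move=> mj; apply/eqP/eqP => [d0|->]; last exact: incK.
by rewrite -(decK mj) d0.
Qed.

Lemma mdeg_dec m j : (0 < m j)%N -> \sum_i m i = (\sum_i dec m j i).+1.
Proof.
move=> mj; rewrite (bigD1 j) //= [in RHS](bigD1 j) //= ffunE eqxx -addSn.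
rewrite -subSn // subn1 /=; congr addn; apply: eq_bigr => i /negPf ij.
by rewrite ffunE ij subn0.
Qed.

End Monomials.
Arguments mon0 {n}.

(** Each pair with i < j cancels its mirror image. The diagonal has its own hypothesis because
    antisymmetry alone does not kill it in characteristic 2. *)
Lemma sum_antisym (V : zmodType) n (G : 'I_n -> 'I_n -> V) :
    (forall i j, G i j = - G j i) -> (forall i, G i i = 0) ->
  \sum_i \sum_j G i j = 0.
Proof.
move=> GN G0.
have split i : \sum_j G i j =
    \sum_(j : 'I_n | (i < j)%N) G i j + \sum_(j : 'I_n | (j < i)%N) G i j.
  rewrite (bigID (fun j : 'I_n => (i < j)%N)) /=; congr +%R.
  rewrite (bigD1 i) /=; last by rewrite ltnn.
  rewrite G0 add0r; apply: eq_bigl => j.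
  by rewrite -leqNgt andbC -val_eqE /= -ltn_neqAle.
rewrite (eq_bigr _ (fun i _ => split i)) big_split /=.
rewrite (exchange_big_dep predT) //= -big_split big1 //= => i _.
rewrite -big_split big1 //= => j _; rewrite GN; exact: addNr.
Qed.

(** * Weighted shifts and linear resolutions in coordinates *)

Section Twist.
Variables (k : fieldType) (n : nat) (a : 'M[k]_n).
Hypothesis a_neq0 : forall i j, a i j != 0.
Hypothesis a_diag : forall i, a i i = 1.
Local Notation M := (mon n).
Implicit Types (m : M) (j : 'I_n).

(* x_j x^m = lam j m x^(m + e_j) *)
Definition lam (j : 'I_n) (m : M) : k := \prod_i a i j ^+ m i.

Lemma lam_neq0 j m : lam j m != 0.
Proof. by apply/prodf_neq0 => i _; rewrite expf_neq0. Qed.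

Lemma lam_mon0 j : lam j mon0 = 1.
Proof. by rewrite /lam big1 // => i _; rewrite ffunE expr0. Qed.

Lemma lam_inc j m (i : 'I_n) : lam j (inc m i) = a i j * lam j m.
Proof.
rewrite /lam (bigD1 i) //= [in RHS](bigD1 i) //= ffunE eqxx addn1 exprS -mulrA.
by congr (_ * (_ * _)); apply: eq_bigr => l /negPf li; rewrite ffunE li addn0.
Qed.

Lemma lam_dec j m (i : 'I_n) : (0 < m i)%N -> lam j m = a i j * lam j (dec m i).
Proof. by move=> mi; rewrite -{1}(decK mi) lam_inc. Qed.

(** With U standing for sum_m x^m U_m, this is the x^m-coefficient of (sum_j x_j D_j) U. The weight
    may be read at m rather than at m - e_j because a_jj = 1. *)
Definition step s t c (D : 'I_n -> 'M[k]_(s, t)) (U : M -> 'M[k]_(t, c))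
    (m : M) : 'M[k]_(s, c) :=
  \sum_(j | (0 < m j)%N) lam j m *: (D j *m U (dec m j)).

(* Bounded support, i.e. finite support. *)
Definition bounded s c (U : M -> 'M[k]_(s, c)) : Prop :=
  exists N, forall m : M, (N < \sum_i m i)%N -> U m = 0.

(** A linear resolution in coordinates: [D i j] is the coefficient matrix of x_j in the i-th
    differential. *)
Record model_resolution (s : nat -> nat)
    (D : forall i : nat, 'I_n -> 'M[k]_(s i.-1, s i)) : Prop := {
  mres_rank0 : s 0%N = 1%N;
  mres_aug : forall U : M -> 'cV[k]_(s 0%N), bounded U ->
    (exists2 W, bounded W & U =1 step (D 1%N) W) <-> U mon0 = 0;
  mres_exact : forall (i : nat) (U : M -> 'cV[k]_(s i.+1)), bounded U ->
    step (D i.+1) U =1 (fun=> 0) <->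
    exists2 W, bounded W & U =1 step (D i.+2) W }.

Lemma eq_step s t c (D : 'I_n -> 'M[k]_(s, t)) (U V : M -> 'M[k]_(t, c)) :
  U =1 V -> step D U =1 step D V.
Proof. by move=> UV m; apply: eq_bigr => j _; rewrite UV. Qed.

Lemma step_mon0 s t c (D : 'I_n -> 'M[k]_(s, t)) (U : M -> 'M[k]_(t, c)) :
  step D U mon0 = 0.
Proof. by rewrite /step big_pred0 // => j; rewrite ffunE. Qed.

Lemma step_mull s s' t c (P : 'M[k]_(s', s)) (D : 'I_n -> 'M[k]_(s, t))
    (U : M -> 'M[k]_(t, c)) m :
  step (fun j => P *m D j) U m = P *m step D U m.
Proof.
rewrite mulmx_sumr; apply: eq_bigr => j _.
by rewrite -scalemxAr mulmxA.
Qed.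

Lemma step_mulr s t c c' (D : 'I_n -> 'M[k]_(s, t)) (U : M -> 'M[k]_(t, c))
    (Q : 'M[k]_(c, c')) m :
  step D (fun m => U m *m Q) m = step D U m *m Q.
Proof.
rewrite mulmx_suml; apply: eq_bigr => j _.
by rewrite -scalemxAl mulmxA.
Qed.

Lemma step_mulm s t t' c (D : 'I_n -> 'M[k]_(s, t)) (P : 'M[k]_(t, t'))
    (U : M -> 'M[k]_(t', c)) m :
  step D (fun m => P *m U m) m = step (fun j => D j *m P) U m.
Proof. by apply: eq_bigr => j _; rewrite mulmxA. Qed.

Definition constU s c (C : 'M[k]_(s, c)) (m : M) :=
  if m == mon0 then C else 0.

(** The linear column sum_j x_j X_j; at most one index contributes, since [mon1] is injective. *)
Definition linU s c (X : 'I_n -> 'M[k]_(s, c)) (m : M) :=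
  \sum_(j | m == mon1 j) X j.

Lemma linU1 s c (X : 'I_n -> 'M[k]_(s, c)) j : linU X (mon1 j) = X j.
Proof.
rewrite /linU (big_pred1 j) // => i; rewrite /= eq_sym.
exact: (inj_eq (@mon1_inj n)).
Qed.

Lemma eq_linU s c (X Y : 'I_n -> 'M[k]_(s, c)) :
  X =1 Y -> linU X =1 linU Y.
Proof. by move=> XY m; apply: eq_bigr. Qed.

Lemma linU_mull s s' c (P : 'M[k]_(s', s)) (X : 'I_n -> 'M[k]_(s, c)) m :
  linU (fun j => P *m X j) m = P *m linU X m.
Proof. by rewrite mulmx_sumr. Qed.

Lemma linU_mulr s c c' (X : 'I_n -> 'M[k]_(s, c)) (Q : 'M[k]_(c, c')) m :
  linU (fun j => X j *m Q) m = linU X m *m Q.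
Proof. by rewrite mulmx_suml. Qed.

Lemma bounded_const s c (C : 'M[k]_(s, c)) : bounded (constU C).
Proof.
exists 0%N => m; rewrite /constU; case: eqP => // ->.
by rewrite big1 // => i _; rewrite ffunE.
Qed.

Lemma bounded_lin s c (X : 'I_n -> 'M[k]_(s, c)) : bounded (linU X).
Proof.
exists 1%N => m m1; rewrite /linU big_pred0 // => j; apply/eqP => mE.
move: m1; rewrite mE (@mdeg_dec _ _ j) ?incj_gt0 // incK.
by rewrite big1 // => i _; rewrite ffunE.
Qed.

Lemma step_const s t c (D : 'I_n -> 'M[k]_(s, t)) (C : 'M[k]_(t, c)) :
  step D (constU C) =1 linU (fun j => D j *m C).
Proof.
move=> m; rewrite /step /linU /constU.
rewrite (bigID (fun j => m == mon1 j)) /= [X in _ + X]big1 ?addr0.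
  apply: eq_big => [j|j /andP [mj /eqP mE]].
    by case: eqP => [->|]; rewrite ?incj_gt0 // andbF.
  by rewrite dec_eq0 // mE eqxx lam_inc a_diag lam_mon0 mulr1 scale1r.
by move=> j /andP [mj /negPf mE]; rewrite dec_eq0 // mE mulmx0 scaler0.
Qed.

(** * Uniqueness of linear resolutions up to scalar matrices *)

Section Comparison.

Section One.
Variables (s : nat -> nat) (D : forall i : nat, 'I_n -> 'M[k]_(s i.-1, s i)).
Hypothesis resD : model_resolution D.

(** Minimality: a constant cycle is a boundary by exactness, and boundaries have no constant
    term. *)
Lemma mres_columns_free i c (C : 'M[k]_(s i.+1, c)) :
  (forall j, D i.+1 j *m C = 0) -> C = 0.
Proof.
move=> DC; suff colC l : col l C = 0.
  by apply/matrixP => r l; have /matrixP/(_ r 0) := colC l; rewrite !mxE.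
have /(mres_exact resD (bounded_const _)) [W _ WE] :
    step (D i.+1) (constU (col l C)) =1 (fun=> 0).
  move=> m; rewrite step_const /linU big1 // => j _.
  by rewrite colE mulmxA DC mul0mx.
by have := WE mon0; rewrite step_mon0 /constU eqxx.
Qed.

(** The columns of [D i.+2] are the boundaries of the constant basis vectors. *)
Lemma mres_linear_cycle i : step (D i.+1) (linU (D i.+2)) =1 (fun=> 0).
Proof.
move=> m; apply/matrixP => r l.
have := mres_exact resD (bounded_lin (fun j => col l (D i.+2 j))).
case=> _ /(_ _)/(_ m) H.
have {}H : step (D i.+1) (linU (fun j => col l (D i.+2 j))) m = 0.
  apply: H; exists (constU (delta_mx l 0)); first exact: bounded_const.
  by move=> m'; rewrite step_const; apply: eq_linU => j; rewrite colE.
move/matrixP: H => /(_ r 0).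
rewrite (_ : step _ _ m = step (D i.+1) (linU (D i.+2)) m *m delta_mx l 0).
  by rewrite -colE !mxE.
rewrite -step_mulr; apply: eq_step => m'.
by rewrite -linU_mulr; apply: eq_linU => j; rewrite colE.
Qed.

(* Every linear column lies in the augmentation ideal, hence the vacuous
   hypothesis for i = 0. *)
Lemma mres_linear_boundary i c (X : 'I_n -> 'M[k]_(s i, c)) :
  (if i is i'.+1 return ('I_n -> 'M[k]_(s i, c)) -> Prop then
     fun X => step (D i'.+1) (linU X) =1 (fun=> 0) else fun=> True) X ->
  exists P : 'M[k]_(s i.+1, c), forall j, X j = D i.+1 j *m P.
Proof.
move=> cycX.
have colX l : exists p : 'cV[k]_(s i.+1), forall j, col l (X j) = D i.+1 j *m p.
  have [W _ WE] : exists2 W : M -> 'cV[k]_(s i.+1),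
      bounded W & linU (fun j => col l (X j)) =1 step (D i.+1) W.
    case: i X cycX => [|i] X cycX.
      apply/(mres_aug resD (bounded_lin _)).
      rewrite /linU big_pred0 // => j; apply/eqP => /esym.
      by move/ffunP/(_ j); rewrite !ffunE eqxx.
    apply/(mres_exact resD (bounded_lin _)) => m.
    transitivity (step (D i.+1) (linU X) m *m delta_mx l (0 : 'I_1)).
      2: by rewrite cycX mul0mx.
    rewrite -step_mulr.
    apply: eq_step => m'; rewrite -linU_mulr.
    by apply: eq_linU => j; rewrite colE.
  (* Only the constant term of W reaches the coefficient of x_j, so a scalar column suffices. *)
  exists (W mon0) => j; rewrite -(linU1 (fun j => col l (X j))) WE.
  rewrite /step (bigD1 j) ?incj_gt0 //= big1 ?addr0.
    by rewrite incK lam_inc a_diag lam_mon0 mulr1 scale1r.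
  by move=> i' /andP [+ /negPf i'j]; rewrite !ffunE i'j.
have [p pE] := fin_all_exists colX.
exists (\matrix_(r, l) p l r 0) => j; apply/matrixP => r l.
have /matrixP/(_ r 0) := pE l j; rewrite !mxE => ->.
by apply: eq_bigr => t _; rewrite !mxE.
Qed.

End One.

(** Given the commuting square one degree lower, the columns of P D_(i+1) are linear cycles, hence
    scalar combinations of the columns of D'_(i+1). *)
Lemma mres_lift s s' (D : forall i : nat, 'I_n -> 'M[k]_(s i.-1, s i))
    (D' : forall i, 'I_n -> 'M[k]_(s' i.-1, s' i)) i P :
    model_resolution D -> model_resolution D' ->
    (if i is i'.+1 return 'M[k]_(s' i, s i) -> Prop then
       fun P => exists P0, forall j, P0 *m D i'.+1 j = D' i'.+1 j *m P
     else fun=> True) P ->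
  exists P1, forall j, P *m D i.+1 j = D' i.+1 j *m P1.
Proof.
move=> resD resD' cP; apply: (mres_linear_boundary resD').
case: i P cP => [//|i] P [P0 P0E] m.
transitivity (P0 *m step (D i.+1) (linU (D i.+2)) m).
  rewrite -step_mull (_ : step _ _ m =
    step (fun j => D' i.+1 j *m P) (linU (D i.+2)) m).
    by apply: eq_bigr => j _; rewrite P0E.
  by rewrite -step_mulm; apply: eq_step => m'; rewrite linU_mull.
by rewrite (mres_linear_cycle resD) mulmx0.
Qed.

(** The identity in rank one lifts degree by degree to scalar chain maps in both directions, and
    [mres_columns_free] forces their composites to be identities. *)
Lemma mres_unique s s' (D : forall i : nat, 'I_n -> 'M[k]_(s i.-1, s i))
    (D' : forall i, 'I_n -> 'M[k]_(s' i.-1, s' i)) i :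
    model_resolution D -> model_resolution D' ->
  exists (P : 'M[k]_(s' i, s i)) (Q : 'M[k]_(s i, s' i))
         (P1 : 'M[k]_(s' i.+1, s i.+1)) (Q1 : 'M[k]_(s i.+1, s' i.+1)),
    [/\ P *m Q = 1%:M, Q *m P = 1%:M, P1 *m Q1 = 1%:M, Q1 *m P1 = 1%:M &
      forall j, P *m D i.+1 j = D' i.+1 j *m P1 /\
                Q *m D' i.+1 j = D i.+1 j *m Q1].
Proof.
move=> resD resD'.
(* The induction also carries the squares below degree i, which the next lift requires. *)
suff start : exists (P : 'M[k]_(s' i, s i)) (Q : 'M[k]_(s i, s' i)),
    [/\ P *m Q = 1%:M, Q *m P = 1%:M,
      (if i is i'.+1 return 'M[k]_(s' i, s i) -> Prop then
       fun P => exists P0, forall j, P0 *m D i'.+1 j = D' i'.+1 j *m P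
      else fun=> True) P &
      (if i is i'.+1 return 'M[k]_(s i, s' i) -> Prop then
       fun Q => exists Q0, forall j, Q0 *m D' i'.+1 j = D i'.+1 j *m Q
      else fun=> True) Q].
  have [P [Q [PQ QP cP cQ]]] := start.
  have [P1 P1E] := mres_lift resD resD' cP.
  have [Q1 Q1E] := mres_lift resD' resD cQ.
  exists P, Q, P1, Q1; split=> //; apply/eqP; rewrite -subr_eq0; apply/eqP.
    apply: (mres_columns_free resD') => j.
    by rewrite mulmxBr mulmx1 mulmxA -P1E -mulmxA -Q1E mulmxA PQ mul1mx subrr.
  apply: (mres_columns_free resD) => j.
  by rewrite mulmxBr mulmx1 mulmxA -Q1E -mulmxA -P1E mulmxA QP mul1mx subrr.
elim: i => [|i [P [Q [PQ QP cP cQ]]]].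
  have s0 := mres_rank0 resD; have s0' := mres_rank0 resD'.
  exists (const_mx 1), (const_mx 1); split=> //; rewrite ?s0 ?s0'.
    apply/matrixP => u v; rewrite !mxE big_ord1 !mxE mulr1.
    by rewrite [u]ord1 [v]ord1.
  apply/matrixP => u v; rewrite !mxE big_ord1 !mxE mulr1.
  by rewrite [u]ord1 [v]ord1.
have [P1 P1E] := mres_lift resD resD' cP.
have [Q1 Q1E] := mres_lift resD' resD cQ.
exists P1, Q1; split; [| |by exists P|by exists Q].
all: apply/eqP; rewrite -subr_eq0; apply/eqP.
  apply: (mres_columns_free resD') => j.
  by rewrite mulmxBr mulmx1 mulmxA -P1E -mulmxA -Q1E mulmxA PQ mul1mx subrr.
apply: (mres_columns_free resD) => j.
by rewrite mulmxBr mulmx1 mulmxA -Q1E -mulmxA -P1E mulmxA QP mul1mx subrr.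
Qed.

Definition evalp s t (D : 'I_n -> 'M[k]_(s, t)) (p : 'rV[k]_n) : 'M[k]_(s, t) :=
  \sum_j p 0 j *: D j.

Lemma evalp_mull s s' t (P : 'M[k]_(s', s)) (D : 'I_n -> 'M[k]_(s, t)) p :
  evalp (fun j => P *m D j) p = P *m evalp D p.
Proof. by rewrite mulmx_sumr; apply: eq_bigr => j _; rewrite scalemxAr. Qed.

Lemma evalp_mulr s t t' (D : 'I_n -> 'M[k]_(s, t)) (Q : 'M[k]_(t, t')) p :
  evalp (fun j => D j *m Q) p = evalp D p *m Q.
Proof. by rewrite mulmx_suml; apply: eq_bigr => j _; rewrite scalemxAl. Qed.

(** Q P = 1 gives the factorization E = Q E' P1. *)
Lemma mxrank_equiv_le s s' t t' (E : 'M[k]_(s, t)) (E' : 'M[k]_(s', t'))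
    (P : 'M[k]_(s', s)) (Q : 'M[k]_(s, s')) (P1 : 'M[k]_(t', t)) :
  Q *m P = 1%:M -> P *m E = E' *m P1 -> (\rank E <= \rank E')%N.
Proof.
move=> QP PE; rewrite -[E]mul1mx -QP -mulmxA PE.
exact: leq_trans (mxrankM_maxr _ _) (mxrankM_maxl _ _).
Qed.

Lemma mres_rank_unique s s' (D : forall i : nat, 'I_n -> 'M[k]_(s i.-1, s i))
    (D' : forall i, 'I_n -> 'M[k]_(s' i.-1, s' i)) i p :
    model_resolution D -> model_resolution D' ->
  \rank (evalp (D i.+1) p) = \rank (evalp (D' i.+1) p).
Proof.
move=> resD resD'.
have [P [Q [P1 [Q1 [PQ QP _ _ E]]]]] := mres_unique i resD resD'.
apply/eqP; rewrite eqn_leq; apply/andP; split.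
  apply: (mxrank_equiv_le QP (P1 := P1)).
  rewrite -evalp_mull -evalp_mulr; apply: eq_bigr => j _.
  by rewrite (E j).1.
apply: (mxrank_equiv_le PQ (P1 := Q1)).
rewrite -evalp_mull -evalp_mulr; apply: eq_bigr => j _.
by rewrite (E j).2.
Qed.

Lemma mres_size_unique s s' (D : forall i : nat, 'I_n -> 'M[k]_(s i.-1, s i))
    (D' : forall i, 'I_n -> 'M[k]_(s' i.-1, s' i)) i :
    model_resolution D -> model_resolution D' -> s i = s' i.
Proof.
move=> resD resD'.
have [P [Q [_ [_ [PQ QP _ _ _]]]]] := mres_unique i resD resD'.
apply/eqP; rewrite eqn_leq -{1}(mxrank1 k (s i)) -{2}(mxrank1 k (s' i)) -PQ -QP.
apply/andP; split; apply: leq_trans (mxrankM_maxl _ _) _; exact: rank_leq_col.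
Qed.

End Comparison.
End Twist.

(** * Coordinates indexed by subsets of fixed size *)

Section LevelCoordinates.
Variables (k : fieldType) (n : nat).
Implicit Types (I J : {set 'I_n}).

(** These J index the basis e_J of the i-th exterior power, the i-th term of the Koszul complex. *)
Definition level (i : nat) := [set J : {set 'I_n} | #|J| == i].

Lemma card_level i : #|level i| = 'C(n, i).
Proof. by rewrite card_draws card_ord. Qed.

Lemma card_enum_level i (t : 'I_#|level i|) : #|enum_val t| = i.
Proof. by apply/eqP; have := enum_valP t; rewrite inE. Qed.

Lemma enum_level i J : #|J| = i -> exists t : 'I_#|level i|, enum_val t = J.
Proof.
move=> Ji; have JL : J \in level i by rewrite inE Ji.
by exists (enum_rank_in JL J); rewrite enum_rankK_in.
Qed.

(* This is 0 when #|J| differs from i. *)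
Definition coord i (u : 'cV[k]_#|level i|) J : k :=
  \sum_(t | enum_val t == J) u t 0.

Definition mkcol i (f : {set 'I_n} -> k) : 'cV[k]_#|level i| :=
  \col_t f (enum_val t).

Lemma coord_enum i (u : 'cV[k]_#|level i|) t : coord u (enum_val t) = u t 0.
Proof.
rewrite /coord (big_pred1 t) // => t'.
by rewrite /= (inj_eq enum_val_inj).
Qed.

Lemma coord_out i (u : 'cV[k]_#|level i|) J : #|J| != i -> coord u J = 0.
Proof.
move=> Ji; rewrite /coord big_pred0 // => t; apply/eqP => tJ.
by rewrite -tJ card_enum_level eqxx in Ji.
Qed.

Lemma coord_mkcol i f J : #|J| = i -> coord (mkcol i f) J = f J.
Proof. by case/enum_level => t <-; rewrite coord_enum mxE. Qed.

Lemma eq_coord i (u v : 'cV[k]_#|level i|) :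
  (forall J, #|J| = i -> coord u J = coord v J) -> u = v.
Proof.
move=> uv; apply/matrixP => t r; rewrite [r]ord1 -!coord_enum.
by rewrite uv // card_enum_level.
Qed.

Lemma coordZ i c (u : 'cV[k]_#|level i|) J : coord (c *: u) J = c * coord u J.
Proof. by rewrite /coord mulr_sumr; apply: eq_bigr => t _; rewrite !mxE. Qed.

Lemma coord0 i J : coord (0 : 'cV[k]_#|level i|) J = 0.
Proof. by rewrite -[0](scale0r 0) coordZ mul0r. Qed.

Lemma coordN i (u : 'cV[k]_#|level i|) J : coord (- u) J = - coord u J.
Proof. by rewrite -scaleN1r coordZ mulN1r. Qed.

Lemma coord_sum i (T : finType) (P : pred T) (F : T -> 'cV[k]_#|level i|) J :
  coord (\sum_(x | P x) F x) J = \sum_(x | P x) coord (F x) J.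
Proof.
rewrite /coord exchange_big /=.
by apply: eq_bigr => t _; rewrite summxE.
Qed.

End LevelCoordinates.

(** * The twisted Koszul complex and its exactness *)

Section Koszul.
Variables (k : fieldType) (n : nat) (a : 'M[k]_n).
Hypothesis a_neq0 : forall i j, a i j != 0.
Hypothesis a_diag : forall i, a i i = 1.
Local Notation M := (mon n).
Implicit Types (J K : {set 'I_n}) (j l : 'I_n) (m : M).

(* The Koszul sign together with the scalar for moving x_j past x_i. *)
Definition sw (i j : 'I_n) : k := (-1) ^+ (i < j)%N * a i j.

(** The scalar with which x_j e_J occurs in the differential of e_(j |: J). *)
Definition weight J j : k := \prod_(i in J) sw i j.

Lemma sw_neq0 (i : 'I_n) j : sw i j != 0.
Proof. by rewrite mulf_neq0 // signr_eq0. Qed.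

Lemma weight_neq0 J j : weight J j != 0.
Proof. by apply/prodf_neq0 => i _; apply: sw_neq0. Qed.

Lemma weightU1 J l j : l \notin J -> weight (l |: J) j = sw l j * weight J j.
Proof. by move=> lJ; rewrite /weight big_setU1. Qed.

(** Exactly one of the two Koszul signs is -1. *)
Lemma sw_skew l j : l != j -> sw l j * a j l = - (sw j l * a l j).
Proof.
rewrite /sw neq_ltn => /orP [] lj; rewrite lj ltnNge ltnW //=.
all: by rewrite ?expr0 ?expr1; ring.
Qed.

(** The x_j-part of the differential, a twisted contraction: e_(j |: J) goes to [weight J j] e_J,
    and e_K goes to 0 when j is not in K. *)
Definition koszul i j : 'M[k]_(#|level n i.-1|, #|level n i|) :=
  \matrix_(r, t) (let J : {set 'I_n} := enum_val r in
    if (j \notin J) && (enum_val t == j |: J) then weight J j else 0).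

Lemma coord_koszul i j (u : 'cV[k]_#|level n i.+1|) J :
  coord (koszul i.+1 j *m u : 'cV_#|level n i|) J =
    if j \notin J then weight J j * coord u (j |: J) else 0.
Proof.
have [/enum_level [t <-]|Ji] := eqVneq #|J| i; last first.
  rewrite coord_out //; case: ifP => // jJ.
  by rewrite coord_out ?mulr0 // cardsU1 jJ eqSS.
rewrite coord_enum mxE; case: ifPn => jJ; last first.
  by rewrite big1 // => t' _; rewrite mxE /= (negPf jJ) mul0r.
rewrite /coord mulr_sumr [RHS]big_mkcond; apply: eq_bigr => t' _.
by rewrite mxE /= jJ; case: eqP => // _; rewrite mul0r.
Qed.

Lemma koszul_sqr0 i j (u : 'cV[k]_#|level n i.+2|) :
  koszul i.+1 j *m (koszul i.+2 j *m u) = 0.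
Proof.
apply: eq_coord => J _; rewrite coord0 coord_koszul; case: ifP => // jJ.
by rewrite coord_koszul setU11 mulr0.
Qed.

(** Both composites remove j and l; their scalars differ only in one factor [sw], and [sw_skew]
    compares these. *)
Lemma koszul_skew i j l (u : 'cV[k]_#|level n i.+2|) : j != l ->
  a l j *: (koszul i.+1 j *m (koszul i.+2 l *m u)) =
  - (a j l *: (koszul i.+1 l *m (koszul i.+2 j *m u))).
Proof.
move=> jl; apply: eq_coord => J _.
rewrite coordN !coordZ !(coord_koszul, in_setU1).
rewrite (negPf jl) eq_sym (negPf jl) /=.
case: ifPn => jJ; case: ifPn => lJ //=; rewrite ?(mulr0, oppr0) //.
rewrite !weightU1 // setUCA.
have := sw_skew jl; move: (coord u _) => c E.
transitivity ((sw j l * a l j) * (weight J j * weight J l * c)); first ring.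
by rewrite E; ring.
Qed.

Lemma step_koszul_sqr0 i (W : M -> 'cV[k]_#|level n i.+2|) m :
  step a (koszul i.+1) (step a (koszul i.+2) W) m = 0.
Proof.
rewrite /step; pose G j l : 'cV[k]_#|level n i| :=
  if (0 < m j)%N && (0 < dec m j l)%N then
    (lam a j m * lam a l (dec m j)) *:
      (koszul i.+1 j *m (koszul i.+2 l *m W (dec (dec m j) l))) else 0.
transitivity (\sum_j \sum_l G j l).
  rewrite big_mkcond; apply: eq_bigr => j _ /=; rewrite /G.
  case: (0 < m j)%N; last by rewrite big1.
  rewrite mulmx_sumr scaler_sumr big_mkcond; apply: eq_bigr => l _ /=.
  by case: ifP => // _; rewrite -scalemxAr scalerA.
apply: sum_antisym => [j l|j]; last first.
  by rewrite /G; case: ifP => // _; rewrite koszul_sqr0 scaler0.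
have [->|jl] := eqVneq j l.
  by rewrite /G; case: ifP; rewrite ?oppr0 // koszul_sqr0 scaler0 oppr0.
rewrite /G !ffunE (eq_sym l j) (negPf jl) !subn0 andbC.
case: ifP => [/andP [ml mj]|]; last by rewrite oppr0.
rewrite -scalerN (decC m l j).
(* The first factor is symmetric in j and l; what remains is the scalar that [koszul_skew] needs. *)
have -> : lam a j m * lam a l (dec m j) =
    (lam a j m * lam a l m / (a l j * a j l)) * a l j.
  by rewrite (lam_dec a l mj); field; rewrite !a_neq0.
have -> : lam a l m * lam a j (dec m l) =
    (lam a j m * lam a l m / (a l j * a j l)) * a j l.
  by rewrite (lam_dec a j ml); field; rewrite !a_neq0.
by rewrite -!scalerA koszul_skew // !scalerN.
Qed.

Lemma coord_step_koszul i (U : M -> 'cV[k]_#|level n i.+1|) m J :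
  coord (step a (koszul i.+1) U m : 'cV_#|level n i|) J =
  \sum_(j | (0 < m j)%N && (j \notin J))
     lam a j m * weight J j * coord (U (dec m j)) (j |: J).
Proof.
rewrite coord_sum big_mkcondr; apply: eq_bigr => j _.
by rewrite coordZ coord_koszul; case: ifP; rewrite ?mulr0 // mulrA.
Qed.

(** A vertex of the simplex on the support of the multidegree, serving as apex of a cone. *)
Definition pivot m K := [pick j | (0 < m j)%N || (j \in K)].

(* The pivot depends only on the multidegree m + sum_(j in K) e_j of x^m e_K,
   which the differential preserves; see pivot_dec. *)
Definition homotopy i (U : M -> 'cV[k]_#|level n i|) m :
    'cV[k]_#|level n i.+1| :=
  mkcol i.+1 (fun K => if pivot m K is Some j then
     if j \in K then (lam a j m * weight (K :\ j) j)^-1 *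
                     coord (U (inc m j)) (K :\ j) else 0 else 0).

Lemma bounded_homotopy i (U : M -> 'cV[k]_#|level n i|) :
  bounded U -> bounded (homotopy U).
Proof.
move=> [N UN]; exists N => m mN; apply/matrixP => t r; rewrite !mxE.
case: pivot => // j; case: ifP => // _; rewrite UN ?coord0 ?mulr0 //.
by rewrite (mdeg_dec (incj_gt0 m j)) incK ltnW.
Qed.

Lemma pivot_dec m J j : (0 < m j)%N -> pivot (dec m j) (j |: J) = pivot m J.
Proof.
move=> mj; apply: eq_pick => l; rewrite /= !ffunE in_setU1.
by case: eqP => [->|]; rewrite ?mj ?orbT //= subn0.
Qed.

(** Coning from the pivot contracts the complex in every nonzero multidegree, so it inverts the
    differential on cycles. For i = 0 the condition [U mon0 = 0] takes the place of the cycle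
    condition. *)
Lemma step_homotopy i (U : M -> 'cV[k]_#|level n i|) m :
    (if i is i'.+1 return (M -> 'cV[k]_#|level n i|) -> Prop then
       fun U => step a (koszul i'.+1) U =1 (fun=> 0)
     else fun U => U mon0 = 0) U ->
  step a (koszul i.+1) (homotopy U) m = U m.
Proof.
move=> cycU; apply: eq_coord => J Ji; rewrite coord_step_koszul.
rewrite (eq_bigr (fun j => lam a j m * weight J j * (if pivot m J is Some l then
    if l \in j |: J then (lam a l (dec m j) * weight ((j |: J) :\ l) l)^-1 *
       coord (U (inc (dec m j) l)) ((j |: J) :\ l) else 0 else 0))); last first.
  move=> j /andP [mj jJ]; rewrite coord_mkcol ?pivot_dec //.
  by rewrite cardsU1 jJ Ji.
rewrite /pivot; case: pickP => [l|m0]; last first.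
  (* Without a pivot m = 0 and J is empty, so i = 0 and the hypothesis is [U mon0 = 0]. *)
  rewrite big1 => [|j _]; last by rewrite mulr0.
  have mE : m = mon0.
    by apply/ffunP => j; have := m0 j; rewrite ffunE lt0n; case: eqP.
  have J0 : #|J| = 0%N.
    by apply/eqP; rewrite cards_eq0; apply/eqP/setP => j; have := m0 j;
       rewrite inE; case: (j \in J); rewrite ?orbT.
  by move: Ji; rewrite J0; case: i U cycU => //= U U0 _; rewrite mE U0 coord0.
have [lJ _|lJ] := boolP (l \in J); last first.
  (* For j different from l the pivot l lies outside j |: J and the homotopy vanishes there; only j
     = l remains. *)
  rewrite orbF => ml; rewrite (bigD1 l) ?ml ?lJ //= big1 ?addr0.
    rewrite setU11 setU1K // decK // (lam_dec a l ml) a_diag mul1r.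
    rewrite mulrA divff ?mul1r // mulf_neq0 ?weight_neq0 //.
    exact: lam_neq0.
  move=> j /andP [_ jl].
  by rewrite in_setU1 (negPf lJ) eq_sym (negPf jl) mulr0.
case: i U cycU Ji => [U _ /eqP|i U cycU Ji].
  by rewrite cards_eq0 => /eqP J0; rewrite J0 inE in lJ.
pose J' := J :\ l.
have lJ' : l \notin J' by rewrite !inE eqxx.
have JE : J = l |: J' by rewrite setD1K.
(* The cycle condition at x^(m + e_l) e_J' expresses the wanted coordinate by the terms S with j
   different from l, which match the sum one by one. *)
have := coord_step_koszul U (inc m l) J'.
rewrite cycU coord0 (bigD1 l) /=; last by rewrite incj_gt0.
rewrite incK lam_inc a_diag mul1r -JE.
set S := (X in _ + X) => /esym/eqP; rewrite addr_eq0 => /eqP SE.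
transitivity (- (lam a l m * weight J' l)^-1 * S); last first.
  rewrite -[S]opprK -SE mulrNN mulKf // mulf_neq0 ?weight_neq0 //.
  exact: lam_neq0.
rewrite /S mulr_sumr; apply: eq_big => [j|j /andP [mj jJ]].
  rewrite JE in_setU1 negb_or !ffunE.
  by case: (j == l); rewrite /= ?andbF ?addn0 ?andbT.
have jl : j != l by apply: contraNneq jJ => ->.
have jJ' : j \notin J' by rewrite in_setD1 (negPf jJ) andbF.
rewrite in_setU1 lJ orbT.
have -> : (j |: J) :\ l = j |: J'.
  by apply/setP => x; rewrite !inE; case: (eqVneq x j) => // ->; rewrite jl.
have -> : inc (dec m j) l = dec (inc m l) j.
  apply/ffunP => x; rewrite !ffunE; case: (eqVneq x j) => [->|_].
    by rewrite (negPf jl) !addn0.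
  by rewrite !subn0.
rewrite lam_inc {1}JE !weightU1 // [LHS]mulrA [RHS]mulrA; congr (_ * _).
rewrite (lam_dec a l mj); have := sw_skew jl.
have nz := (lam_neq0 a_neq0 l (dec m j), weight_neq0 J' l, a_neq0, sw_neq0).
move: (sw_neq0 l j) (sw_neq0 j l); move: (sw j l) (sw l j) => x y y0 x0 E.
(* [sw_skew] eliminates one switching scalar, leaving a field identity. *)
have -> : x = - (y * a j l) / a l j.
  by rewrite -E mulfK.
by field; rewrite oppr_eq0 mulf_eq0 negb_or !nz y0.
Qed.

Theorem koszul_resolution : model_resolution a koszul.
Proof.
split=> [|U bU|i U bU]; first last.
- split=> [cyc|[W _ WE] m]; last first.
    by rewrite (eq_step a _ WE) step_koszul_sqr0.
  exists (homotopy U); first exact: bounded_homotopy.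
  by move=> m; rewrite step_homotopy.
- split=> [[W _ ->]|U0]; first by rewrite step_mon0.
  exists (homotopy U); first exact: bounded_homotopy.
  by move=> m; rewrite step_homotopy.
rewrite -[RHS](cards1 (set0 : {set 'I_n})); apply: eq_card => J.
by rewrite !inE cards_eq0.
Qed.

(** * Ranks of the Koszul differentials at points *)

(** The rows J and columns j0 |: J, for i-subsets J avoiding j0, cut out a diagonal submatrix: when
    j0 is not in J, j |: J contains j0 only for j = j0. The diagonal entries are nonzero multiples
    of p_j0. *)
Lemma mxrank_koszul_ge i (p : 'rV[k]_n) j0 : p 0 j0 != 0 ->
  ('C(n.-1, i) <= \rank (evalp (koszul i.+1) p))%N.
Proof.
move=> pj0; set E := evalp _ _.
pose S := [set J : {set 'I_n} | J \subset [set~ j0] & #|J| == i].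
have SP (t : 'I_#|S|) : j0 \notin enum_val t /\ #|enum_val t| = i.
  have := enum_valP t; rewrite inE subsetC sub1set inE.
  by case/andP => ? /eqP.
have /fin_all_exists [f fE] (t : 'I_#|S|) :
    exists r : 'I_#|level n i|, enum_val r = enum_val t.
  by apply: enum_level; case: (SP t).
have /fin_all_exists [g gE] (t : 'I_#|S|) :
    exists r : 'I_#|level n i.+1|, enum_val r = j0 |: enum_val t.
  by apply: enum_level; rewrite cardsU1; case: (SP t) => -> ->.
pose d := \row_(t < #|S|) (p 0 j0 * weight (enum_val t) j0).
have EE : mxsub f g E = diag_mx d.
  apply/matrixP => t t'; rewrite !mxE summxE (bigD1 j0) //= big1 ?addr0.
    have gf : (enum_val (g t') == j0 |: enum_val (f t)) = (t == t').
      rewrite fE gE; apply/eqP/eqP => [E0|-> //]; apply: enum_val_inj.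
      by rewrite -(setU1K (SP t).1) -E0 setU1K ?(SP t').1.
    rewrite !mxE /= gf fE (SP t).1 /=.
    by case: eqP => _; rewrite ?mulr1n // mulr0.
  move=> j jj0; rewrite !mxE /= fE gE.
  case: ifP => [/andP [jt /eqP E0]|_]; last first.
    by rewrite mulr0.
  have : j0 \in j |: enum_val t by rewrite -E0 setU11.
  by rewrite in_setU1 eq_sym (negPf jj0) (negPf (SP t).1).
have <- : #|S| = 'C(n.-1, i).
  by rewrite cards_draws cardsC1 card_ord.
have <- : \rank (diag_mx d) = #|S|.
  apply: mxrank_unit; rewrite unitmxE det_diag unitfE.
  by apply/prodf_neq0 => t _; rewrite mxE mulf_neq0 ?weight_neq0.
rewrite -EE -[X in mxsub f g X]mulmx1 mxsub_mul.
by apply: leq_trans (mxrankM_maxl _ _) _; rewrite mxrankS ?rowsub_sub.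
Qed.

(** In the expansion over (j, l), the relation between y and p turns the twisted anticommutation of
    [koszul_skew] into plain antisymmetry. *)
Lemma koszul_point_complex i (y p : 'rV[k]_n) :
    (forall j l, y 0 l * p 0 j * a l j = a j l * (y 0 j * p 0 l)) ->
  (evalp (koszul i.+1) y : 'M_(#|level n i|, _)) *m evalp (koszul i.+2) p = 0.
Proof.
move=> yp; suff col0 t : evalp (koszul i.+1) y *m (evalp (koszul i.+2) p *m
    delta_mx t (0 : 'I_1)) = 0 :> 'cV_#|level n i|.
  apply/matrixP => r t; have /matrixP/(_ r 0) := col0 t.
  by rewrite mulmxA -colE !mxE.
set u := delta_mx t _.
transitivity (\sum_j \sum_l (y 0 j * p 0 l) *:
    (koszul i.+1 j *m (koszul i.+2 l *m u)) : 'cV_#|level n i|).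
  rewrite {1}/evalp mulmx_suml; apply: eq_bigr => j _.
  rewrite {1}/evalp mulmx_suml mulmx_sumr; apply: eq_bigr => l _.
  by rewrite -!scalemxAl -scalemxAr scalerA.
apply: sum_antisym => [j l|j]; last by rewrite koszul_sqr0 scaler0.
have [->|jl] := eqVneq j l; first by rewrite koszul_sqr0 scaler0 oppr0.
have -> : y 0 j * p 0 l = (y 0 j * p 0 l / a l j) * a l j.
  by rewrite mulfVK.
rewrite -scalerA koszul_skew // scalerN scalerA; congr (- (_ *: _)).
by apply: (mulIf (a_neq0 l j)); rewrite yp; field; rewrite a_neq0.
Qed.

(** For i > 0 the vanishing product with K_i(y) bounds the rank at p by C(n, i) - C(n-1, i-1); for i
    = 0 there is a single row. *)
Lemma mxrank_koszul i (y p : 'rV[k]_n) j0 :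
    (forall j l, y 0 l * p 0 j * a l j = a j l * (y 0 j * p 0 l)) ->
    y 0 j0 != 0 -> p 0 j0 != 0 ->
  \rank (evalp (koszul i.+1) p) = 'C(n.-1, i).
Proof.
move=> yp yj0 pj0; apply/eqP; rewrite eqn_leq (mxrank_koszul_ge _ pj0) andbT.
have n0 : n = n.-1.+1 by rewrite prednK //; apply: leq_ltn_trans (ltn_ord j0).
case: i => [|i].
  by apply: leq_trans (rank_leq_row _) _; rewrite card_level !bin0.
have := mulmx0_rank_max (koszul_point_complex i yp).
have := mxrank_koszul_ge i yj0.
move: (\rank _) => u; move: (\rank (evalp _ p)) => v ge.
rewrite card_level {1}n0 binS addnC => le.
by rewrite -(leq_add2r u); apply: leq_trans le _; rewrite leq_add2l.
Qed.

Theorem mres_point_exact s (D : forall i : nat, 'I_n -> 'M[k]_(s i.-1, s i))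
    (y p : 'rV[k]_n) i :
    model_resolution a D -> y != 0 -> p != 0 ->
    (forall j l, y 0 l * p 0 j * a l j = a j l * (y 0 j * p 0 l)) ->
  (\rank (evalp (D i.+1) p) + \rank (evalp (D i.+2) p))%N = s i.+1.
Proof.
move=> resD y0 p0 yp.
have [j0 yj0] : exists j, y 0 j != 0.
  apply/existsP; apply: contraNT y0; rewrite negb_exists => /forallP y0.
  by apply/eqP/rowP => j; rewrite mxE; apply/eqP; have := y0 j; rewrite negbK.
have [j1 pj1] : exists j, p 0 j != 0.
  apply/existsP; apply: contraNT p0; rewrite negb_exists => /forallP p0.
  by apply/eqP/rowP => j; rewrite mxE; apply/eqP; have := p0 j; rewrite negbK.
(* If p_j0 were 0, the relation for j1 and j0 would force y_j0 p_j1 = 0. *)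
have pj0 : p 0 j0 != 0.
  apply/eqP => pj0; have /eqP := yp j1 j0.
  by rewrite pj0 !mulr0 !mulf_eq0 (negPf yj0) (negPf pj1) (negPf (a_neq0 _ _)).
have resK := koszul_resolution.
rewrite !(mres_rank_unique a_diag _ p resD resK).
rewrite (mres_size_unique a_diag _ resD resK) !(mxrank_koszul _ yp yj0 pj0).
rewrite card_level [X in _ = 'C(X, _)](_ : n = n.-1.+1) ?binS 1?addnC //.
by rewrite prednK //; apply: leq_ltn_trans (ltn_ord j0).
Qed.

End Koszul.

(** * Passage from modules to the coordinate model *)

(** The maps T are bijections onto the finitely supported functions and carry [bd] to [step], so
    images and kernels correspond. The modules stay abstract so that columns and rows share one
    argument. *)
Lemma model_resolution_transport (k : fieldType) n (a : 'M[k]_n)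
    (s : nat -> nat) (D : forall i : nat, 'I_n -> 'M[k]_(s i.-1, s i))
    (X : nat -> Type) (zero : forall i, X i) (bd : forall i, X i.+1 -> X i)
    (irr : X 0%N -> Prop) (T : forall i, X i -> mon n -> 'cV[k]_(s i)) :
    (forall i (u : X i), bounded (T i u)) ->
    (forall i U, bounded U -> exists u, T i u =1 U) ->
    (forall i u v, T i u =1 T i v -> u = v) ->
    (forall i, T i (zero i) =1 (fun=> 0)) ->
    (forall i w, T i (bd i w) =1 step a (D i.+1) (T i.+1 w)) ->
    (forall u, irr u <-> T 0%N u mon0 = 0) ->
  [/\ s 0%N = 1%N,
      forall u, (exists w, u = bd 0%N w) <-> irr u &
      forall i (u : X i.+1), bd i u = zero i <-> exists w, u = bd i.+1 w] <->
  model_resolution a D.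
Proof.
move=> bT surjT injT T0 Tbd irrE.
have im i u : (exists w, u = bd i w) <->
    exists2 W, bounded W & T i u =1 step a (D i.+1) W.
  split=> [[w ->]|[W /surjT [w wW] uW]]; first by exists (T i.+1 w).
  by exists w; apply: injT => m; rewrite uW Tbd; apply/esym/eq_step.
have ker i u : bd i u = zero i <-> step a (D i.+1) (T i.+1 u) =1 (fun=> 0).
  split=> [u0 m|u0]; first by rewrite -Tbd u0 T0.
  by apply: injT => m; rewrite Tbd u0 T0.
split=> [[s0 aug ex]|[s0 aug ex]]; split=> //.
- move=> U bU; have [u uU] := surjT _ _ bU.
  rewrite -uU -irrE -aug im; split=> -[W bW UW]; exists W => // m.
    by rewrite uU UW.
  by rewrite -UW -uU.
- move=> i U bU; have [u uU] := surjT _ _ bU.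
  have stepE : step a (D i.+1) (T i.+1 u) =1 step a (D i.+1) U.
    exact: eq_step.
  split=> [U0|[W bW UW]].
    have /ex/im [W bW uW] : bd i u = zero i.
      by apply/ker => m; rewrite stepE U0.
    by exists W => // m; rewrite -uU uW.
  have /ex/ker u0 : exists w, u = bd i.+1 w.
    by apply/im; exists W => // m; rewrite uU UW.
  by move=> m; rewrite -stepE u0.
- by move=> u; rewrite im irrE aug.
- by move=> i u; rewrite ker im; apply: ex.
Qed.

Definition component (k : fieldType) n s t (D : 'M['rV[k]_n]_(s, t))
    (j : 'I_n) : 'M[k]_(s, t) :=
  map_mx (fun v : 'rV[k]_n => v 0 j) D.

Lemma mxeval_component (k : fieldType) n s t (D : 'M['rV[k]_n]_(s, t)) p :
  mxeval D p = evalp (component D) p.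
Proof.
apply/matrixP => r c; rewrite !mxE summxE; apply: eq_bigr => j _.
by rewrite !mxE mulrC.
Qed.

Lemma mxeval_component_tr (k : fieldType) n s t (D : 'M['rV[k]_n]_(s, t)) p :
  (mxeval D p)^T = evalp (fun j => (component D j)^T) p.
Proof.
apply/matrixP => r c; rewrite !mxE summxE; apply: eq_bigr => j _.
by rewrite !mxE mulrC.
Qed.

(** * Words and their exponent vectors *)

Section Words.
Variable n : nat.
Local Notation M := (mon n).
Implicit Types (w : seq 'I_n) (m : M) (j : 'I_n).

Definition content w : M := [ffun i => count_mem i w].

Lemma content_cons j w : content (j :: w) = inc (content w) j.
Proof. by apply/ffunP => i; rewrite !ffunE /= addnC eq_sym. Qed.

Lemma content_rcons j w : content (rcons w j) = inc (content w) j.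
Proof.
by apply/ffunP => i; rewrite !ffunE -cats1 count_cat /= addn0 eq_sym.
Qed.

Lemma content_nil : content [::] = mon0.
Proof. by apply/ffunP => i; rewrite !ffunE. Qed.

Lemma inc_eq m m' j : (inc m j == m') = (0 < m' j)%N && (m == dec m' j).
Proof.
apply/eqP/andP => [<-|[mj /eqP ->]]; last exact: decK.
by rewrite incj_gt0 incK.
Qed.

Lemma mdeg_content w : (\sum_i content w i)%N = size w.
Proof.
elim: w => [|j w IHw]; first by rewrite big1 // => i _; rewrite ffunE.
by rewrite content_cons (mdeg_dec (incj_gt0 _ j)) incK IHw.
Qed.

Definition word_of m : seq 'I_n := flatten [seq nseq (m i) i | i <- enum 'I_n].

Lemma word_ofK m : content (word_of m) = m.
Proof.
apply/ffunP => i; rewrite ffunE count_flatten -map_comp sumnE big_map.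
rewrite big_enum (bigD1 i) //= big1 ?addn0 => [|j /negPf ji].
  by rewrite count_nseq /= eqxx mul1n.
by rewrite count_nseq /= ji.
Qed.

Lemma perm_word_of w : perm_eq w (word_of (content w)).
Proof.
apply/allP => i _ /=; have /ffunP/(_ i) := word_ofK (content w).
by rewrite !ffunE => ->.
Qed.

End Words.

(** * Normal forms in the free algebra *)

Section FreeAlgebraForm.
Variables (k : fieldType) (n : nat) (a : 'M[k]_n).
Hypothesis a_neq0 : forall i j, a i j != 0.
Hypothesis a_diag : forall i, a i i = 1.
Local Notation M := (mon n).
Local Notation F := (free_alg k n).
Implicit Types (w : seq 'I_n) (m : M) (f g : F).

Lemma scale_word c w : c *: << FMonom w >> = << c *g FMonom w >> :> F.
Proof. by apply/malgP => v; rewrite mcoeffZ !mcoeffU mulr_natr. Qed.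

Lemma free_alg_ind (P : F -> Prop) :
  P 0 -> (forall f g, P f -> P g -> P (f + g)) ->
  (forall c w, P (c *: << FMonom w >>)) -> forall f, P f.
Proof.
move=> P0 PD PU f; rewrite [f]monalgE; apply: big_ind => // -[w] _.
by rewrite -scale_word.
Qed.

Lemma free_alg_scaleAr c f g : f * (c *: g) = c *: (f * g).
Proof.
elim/free_alg_ind: f => [|f f' IHf IHf'|b w].
- by rewrite !mul0r scaler0.
- by rewrite !mulrDl scalerDr IHf IHf'.
elim/free_alg_ind: g => [|g g' IHg IHg'|b' v].
- by rewrite scaler0 mulr0 scaler0.
- by rewrite scalerDr !mulrDr scalerDr IHg IHg'.
rewrite scalerA !scale_word !malgM_def !fgmulUU; apply/malgP => u.
by rewrite mcoeffZ !mcoeffU mulrnAr mulrCA.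
Qed.

Lemma word_cons j w : << FMonom (j :: w) >> = gen k j * << FMonom w >> :> F.
Proof.
rewrite malgM_def fgmulUU mulr1; congr << _ >>; apply/eqP; rewrite fmP.
by rewrite fmM fmU.
Qed.

Lemma word_rcons j w : << FMonom (rcons w j) >> = << FMonom w >> * gen k j :> F.
Proof.
rewrite malgM_def fgmulUU mulr1; congr << _ >>; apply/eqP; rewrite fmP.
by rewrite fmM fmU cats1.
Qed.

Lemma word_nil : << FMonom [::] >> = 1 :> F.
Proof. by congr << _ >>; apply/eqP; rewrite fmP fm1. Qed.

(* The class of w is word_coef w x^(content w). *)
Fixpoint word_coef (w : seq 'I_n) : k :=
  if w is j :: w then lam a j (content w) * word_coef w else 1.

Lemma word_coef_neq0 w : word_coef w != 0.
Proof.
by elim: w => [|j w IHw] /=; rewrite ?oner_neq0 // mulf_neq0 // lam_neq0.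
Qed.

(** Appending x_j on the right brings in the scalars a_ji instead of a_ij; hence the transpose for
    left modules. *)
Lemma word_coef_rcons w j :
  word_coef (rcons w j) = word_coef w * lam a^T j (content w).
Proof.
elim: w => [|i w IHw] /=.
  by rewrite content_nil !lam_mon0 mulr1.
rewrite content_rcons content_cons !lam_inc mxE IHw; ring.
Qed.

(** The x^m-coefficient of the class of f, defined linearly on words before the x^m are known to be
    a basis. *)
Definition normal_coef m (f : F) : k :=
  mmap idfun (fun w : {fmonom 'I_n} => word_coef w * (content w == m)%:R) f.

Lemma normal_coef_is_additive m : zmod_morphism (normal_coef m).
Proof. exact: mmap_is_additive. Qed.

HB.instance Definition _ m := GRing.isZmodMorphism.Build F k (normal_coef m)
  (normal_coef_is_additive m).

Lemma normal_coefZ m c f : normal_coef m (c *: f) = c * normal_coef m f.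
Proof.
rewrite /normal_coef (mmapEw (msuppZ_le _ _)) mmapE mulr_sumr.
by apply: eq_bigr => w _; rewrite /= mcoeffZ -mulrA.
Qed.

Lemma normal_coef_word m w :
  normal_coef m << FMonom w >> = word_coef w * (content w == m)%:R.
Proof. by rewrite /normal_coef mmapU mul1r. Qed.

(** Checked on words, where a_jj = 1 moves the weight from m - e_j to m, as in [step]. *)
Lemma normal_coef_genl m j f : normal_coef m (gen k j * f) =
  if (0 < m j)%N then lam a j m * normal_coef (dec m j) f else 0.
Proof.
elim/free_alg_ind: f => [|f g IHf IHg|c w].
- by rewrite mulr0 !raddf0 mulr0 if_same.
- by rewrite mulrDr !raddfD /= IHf IHg mulrDr; case: ifP; rewrite ?addr0.
rewrite free_alg_scaleAr -word_cons !normal_coefZ !normal_coef_word /=.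
rewrite content_cons inc_eq; case: ifP => mj; rewrite /= ?mulr0 //.
rewrite (lam_dec a j mj) a_diag.
by case: eqP => [<-|_]; rewrite /= ?mulr0 //; ring.
Qed.

Lemma normal_coef_genr m j f : normal_coef m (f * gen k j) =
  if (0 < m j)%N then lam a^T j m * normal_coef (dec m j) f else 0.
Proof.
elim/free_alg_ind: f => [|f g IHf IHg|c w].
- by rewrite mul0r !raddf0 mulr0 if_same.
- by rewrite mulrDl !raddfD /= IHf IHg mulrDr; case: ifP; rewrite ?addr0.
rewrite -scalerAl -word_rcons !normal_coefZ !normal_coef_word.
rewrite word_coef_rcons content_rcons inc_eq.
case: ifP => mj; rewrite /= ?mulr0 //.
rewrite (lam_dec a^T j mj) mxE a_diag.
by case: eqP => [<-|_]; rewrite /= ?mulr0 //; ring.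
Qed.

(** Together with [normal_coef_mulr], this makes the common kernel of all [normal_coef m] a
    two-sided ideal. *)
Lemma normal_coef_mull f g :
  (forall m, normal_coef m g = 0) -> forall m, normal_coef m (f * g) = 0.
Proof.
move=> g0; elim/free_alg_ind: f => [m|f f' IHf IHf' m|c w].
- by rewrite mul0r raddf0.
- by rewrite mulrDl raddfD /= IHf IHf' addr0.
suff H m : normal_coef m (<< FMonom w >> * g) = 0.
  by move=> m; rewrite -scalerAl normal_coefZ H mulr0.
elim: w m => [|j w IHw] m; first by rewrite word_nil mul1r.
by rewrite word_cons -mulrA normal_coef_genl IHw mulr0 if_same.
Qed.

Lemma normal_coef_mulr f g :
  (forall m, normal_coef m g = 0) -> forall m, normal_coef m (g * f) = 0.
Proof.
move=> g0; elim/free_alg_ind: f => [m|f f' IHf IHf' m|c w].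
- by rewrite mulr0 raddf0.
- by rewrite mulrDr raddfD /= IHf IHf' addr0.
suff H m : normal_coef m (g * << FMonom w >>) = 0.
  by move=> m; rewrite free_alg_scaleAr normal_coefZ H mulr0.
elim/last_ind: w m => [|w j IHw] m; first by rewrite word_nil mulr1.
by rewrite word_rcons mulrA normal_coef_genr IHw mulr0 if_same.
Qed.

Lemma normal_coef_mon0 f : normal_coef mon0 f = f@_mone.
Proof.
elim/free_alg_ind: f => [|f g IHf IHg|c w]; rewrite ?raddf0 //.
  by rewrite !raddfD /= IHf IHg.
rewrite normal_coefZ normal_coef_word mcoeffZ mcoeffU; congr (_ * _).
case: w => [|j w].
  by rewrite content_nil eqxx mulr1 [_ == mone]fmP fm1 eqxx.
by rewrite content_cons inc_eq ffunE mulr0 [_ == mone]fmP fm1.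
Qed.

Lemma normal_coef_bounded f :
  exists N, forall m, (N < \sum_i m i)%N -> normal_coef m f = 0.
Proof.
elim/free_alg_ind: f => [|f g [N fN] [N' gN]|c w].
- by exists 0%N => m _; rewrite raddf0.
- exists (maxn N N') => m; rewrite gtn_max => /andP [mN mN'].
  by rewrite raddfD /= fN // gN // addr0.
exists (size w) => m mw; rewrite normal_coefZ normal_coef_word.
case: eqP => [mE|_]; last by rewrite !mulr0.
by rewrite -mE mdeg_content ltnn in mw.
Qed.

(** Scaled so that its class is exactly x^(content w). *)
Definition normal_word w : F := (word_coef w)^-1 *: << FMonom w >>.

Lemma normal_coef_normal_word m w :
  normal_coef m (normal_word w) = (content w == m)%:R.
Proof.
by rewrite normal_coefZ normal_coef_word mulKf // word_coef_neq0.
Qed.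

Lemma normal_coef_surj (U : M -> k) N :
  (forall m, (N < \sum_i m i)%N -> U m = 0) ->
  exists f, forall m, normal_coef m f = U m.
Proof.
(* Exponent vectors with entries at most N form a finite type, over which the preimage can be
   summed. *)
move=> UN; pose ev (t : {ffun 'I_n -> 'I_N.+1}) : M := [ffun i => t i : nat].
exists (\sum_t U (ev t) *: normal_word (word_of (ev t))) => m.
have coefE t : normal_coef m (U (ev t) *: normal_word (word_of (ev t))) =
    U (ev t) * (ev t == m)%:R.
  by rewrite normal_coefZ normal_coef_normal_word word_ofK.
rewrite raddf_sum (eq_bigr _ (fun t _ => coefE t)).
have [mN|mN] := leqP (\sum_i m i)%N N; last first.
  rewrite [RHS]UN // big1 // => t _.
  by case: eqP => [->|_]; rewrite ?mulr0 // UN ?mul0r.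
pose t : {ffun 'I_n -> 'I_N.+1} := [ffun i => inord (m i)].
have tE : ev t = m.
  apply/ffunP => i; rewrite !ffunE inordK // ltnS; apply: leq_trans mN.
  by rewrite (bigD1 i) //= leq_addr.
rewrite (bigD1 t) //= big1 ?addr0 => [|t' t't].
  by rewrite tE eqxx mulr1.
case: eqP => [t'E|]; last by rewrite mulr0.
case/eqP: t't; apply/ffunP => i; apply: val_inj.
by move/ffunP/(_ i): t'E; rewrite -[in RHS]tE !ffunE.
Qed.

End FreeAlgebraForm.

(** * The monomial basis of the skew polynomial algebra *)

Section SkewPolynomials.
Variables (k : fieldType) (n : nat) (q a : 'M[k]_n).
Hypothesis a_neq0 : forall i j, a i j != 0.
Hypothesis a_diag : forall i, a i i = 1.
Hypothesis a_skew : forall i j, a i j = q i j * a j i.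
Local Notation M := (mon n).
Local Notation F := (free_alg k n).
Local Notation R := (skew_relations q).
Local Notation I := (rel_ideal R).
Local Notation A := (quad_alg R).
Local Notation normal_word := (normal_word a).
Local Notation normal_coef := (normal_coef a).
Implicit Types (w : seq 'I_n) (m : M) (i j : 'I_n) (f g : F).

Lemma skew_relation_mem i j :
  delta_mx j i - q i j *: delta_mx i j \in R.
Proof.
apply: (subvP (sumv_sup i _ (subvv _))) => //.
by apply: (subvP (sumv_sup j _ (subvv _))) => //; rewrite memv_line.
Qed.

Lemma quadform_is_linear : linear (@quadform k n).
Proof.
move=> c f g; rewrite /quadform scaler_sumr -big_split; apply: eq_bigr => i _.
rewrite scaler_sumr -big_split; apply: eq_bigr => j _ /=.
by rewrite !mxE scalerDl scalerA.
Qed.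

HB.instance Definition _ :=
  GRing.isLinear.Build k 'M[k]_n F _ (@quadform k n) quadform_is_linear.

Lemma quadform_delta i j : quadform (delta_mx i j) = gen k i * gen k j.
Proof.
have rows l : l != i ->
    \sum_l' (delta_mx i j : 'M[k]_n) l l' *: (gen k l * gen k l') = 0.
  by move=> /negPf li; apply: big1 => l' _; rewrite mxE li scale0r.
have cols l : l != j ->
    (delta_mx i j : 'M[k]_n) i l *: (gen k i * gen k l) = 0.
  by move=> /negPf lj; rewrite mxE lj andbF scale0r.
rewrite /quadform (bigD1 i) //= (big1 _ _ _ rows) addr0.
by rewrite (bigD1 j) //= (big1 _ _ _ cols) addr0 mxE !eqxx scale1r.
Qed.

Lemma gen_gen i j : gen k i * gen k j = << FMonom [:: i; j] >> :> F.
Proof. by rewrite !word_cons word_nil mulr1. Qed.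

Lemma quadform_relation i j c :
  quadform (delta_mx j i - c *: delta_mx i j) =
  gen k j * gen k i - c *: (gen k i * gen k j).
Proof. by rewrite -!quadform_delta -[c *: quadform _]linearZ -[RHS]linearB. Qed.

(** The words x_j x_i and x_i x_j have the same content and the coefficients a_ij and a_ji, whose
    ratio is q_ij. *)
Lemma normal_coef_relation (r : 'M[k]_n) m :
  r \in R -> normal_coef m (quadform r) = 0.
Proof.
move=> /memv_sumP [r_ rR ->].
rewrite [quadform _]linear_sum raddf_sum big1 // => i _ /=.
have /memv_sumP [r' r'R ->] := rR i isT.
rewrite [quadform _]linear_sum raddf_sum big1 // => j _ /=.
have /vlineP [c ->] := r'R j isT.
rewrite [quadform _]linearZ /= normal_coefZ quadform_relation.
suff -> : normal_coef m (gen k j * gen k i - q i j *: (gen k i * gen k j)) = 0.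
  by rewrite mulr0.
transitivity (word_coef a [:: j; i] * (content [:: j; i] == m)%:R -
    q i j * (word_coef a [:: i; j] * (content [:: i; j] == m)%:R)).
  rewrite raddfB; congr (_ - _).
    by rewrite gen_gen; exact: normal_coef_word.
  rewrite /= normal_coefZ; congr (_ * _).
  by rewrite gen_gen; exact: normal_coef_word.
have -> : content [:: i; j] = content [:: j; i].
  by apply/ffunP => l; rewrite !ffunE /= addnCA.
rewrite /word_coef !content_cons content_nil !lam_inc !lam_mon0 !mulr1 a_skew.
by rewrite mulrA subrr.
Qed.

Lemma normal_coef_ideal f m : f \in I -> normal_coef m f = 0.
Proof.
move=> /asboolP [s /allP sR ->].
rewrite raddf_sum big1_seq // => t /andP [_ ts].
apply: (normal_coef_mulr a_diag) => {}m.
apply: (normal_coef_mull a_diag) => {}m.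
exact/normal_coef_relation/sR.
Qed.

Lemma quadform_ideal (r : 'M[k]_n) : r \in R -> quadform r \in I.
Proof.
move=> rR; apply/asboolP; exists [:: (1, r, 1)]; first by rewrite /= rR.
by rewrite big_seq1 mul1r mulr1.
Qed.

Lemma ideal_scale c f : f \in I -> c *: f \in I.
Proof. by move=> fI; rewrite -mul_malgC rel_idealMl. Qed.

Lemma normal_word_cons j w :
  normal_word (j :: w) = (lam a j (content w))^-1 *: (gen k j * normal_word w).
Proof.
by rewrite /normal_word free_alg_scaleAr scalerA -word_cons /= invfM.
Qed.

Lemma normal_word_cons_ideal j w w' : perm_eq w w' ->
  normal_word w - normal_word w' \in I ->
  normal_word (j :: w) - normal_word (j :: w') \in I.
Proof.
move=> ww' wI; rewrite !normal_word_cons.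
have -> : content w = content w'.
  by apply/ffunP => i; rewrite !ffunE; move/permP: ww'.
by rewrite -scalerBr -mulrBr ideal_scale // rel_idealMl.
Qed.

(** The difference is a scalar multiple of a defining relation times [normal_word w]. *)
Lemma normal_word_swap_ideal i j w :
  normal_word (i :: j :: w) - normal_word (j :: i :: w) \in I.
Proof.
have nw2 u v : normal_word (u :: v :: w) =
    (a v u * lam a u (content w) * lam a v (content w))^-1 *:
      (gen k u * gen k v * normal_word w).
  rewrite normal_word_cons content_cons lam_inc normal_word_cons.
  by rewrite free_alg_scaleAr scalerA mulrA -invfM.
pose l := lam a i (content w); pose l' := lam a j (content w).
pose g := quadform (delta_mx j i - q i j *: delta_mx i j) * normal_word w.
have q0 : q i j != 0 by have := a_neq0 i j; rewrite a_skew mulf_eq0 => /norP [].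
suff -> : normal_word (i :: j :: w) - normal_word (j :: i :: w) =
    - ((a i j * l * l')^-1 *: g).
  rewrite rpredN ideal_scale // rel_idealMr // quadform_ideal //.
  exact: skew_relation_mem.
pose X := gen k i * gen k j * normal_word w.
pose Y := gen k j * gen k i * normal_word w.
have gE : g = Y - q i j *: X.
  rewrite /g quadform_relation mulrBl; congr (_ - _).
  exact/esym/scalerAl.
transitivity ((a j i * l * l')^-1 *: X - (a i j * l' * l)^-1 *: Y).
  exact: (congr2 (fun x y => x - y) (nw2 i j) (nw2 j i)).
have eX : (a j i * l * l')^-1 = (a i j * l * l')^-1 * q i j.
  by rewrite (a_skew i j); field; rewrite q0 a_neq0 !lam_neq0.
have eY : (a i j * l' * l)^-1 = (a i j * l * l')^-1 by rewrite mulrAC.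
clearbody X Y g; rewrite gE scalerBr opprB scalerA.
exact: (congr2 (fun x y => x *: X - y *: Y) eX eY).
Qed.

Lemma ideal_congr_trans g f h : f - g \in I -> g - h \in I -> f - h \in I.
Proof. by move=> fg gh; rewrite -[f](subrK g) -addrA rpredD. Qed.

Lemma ideal_congr_sym f g : f - g \in I -> g - f \in I.
Proof. by rewrite -opprB rpredN. Qed.

Lemma normal_word_move_ideal j u v :
  normal_word (u ++ j :: v) - normal_word (j :: u ++ v) \in I.
Proof.
elim: u => [|i u IHu]; first by rewrite subrr rpred0.
have p : perm_eq (u ++ j :: v) (j :: u ++ v) by rewrite -cat1s perm_catCA.
exact: ideal_congr_trans (normal_word_cons_ideal i p IHu)
  (normal_word_swap_ideal i j (u ++ v)).
Qed.

(** The first letter of w is moved to the front of w', and induction treats the tails. *)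
Lemma normal_word_perm_ideal w w' : perm_eq w w' ->
  normal_word w - normal_word w' \in I.
Proof.
elim: w w' => [|j w IHw] w' ww'.
  by rewrite perm_sym in ww'; rewrite (perm_nilP ww') subrr rpred0.
have jw' : j \in w' by rewrite -(perm_mem ww') mem_head.
case/splitPr: jw' ww' => u v; rewrite perm_sym -cat1s perm_catCA perm_cons.
rewrite perm_sym => p.
exact: ideal_congr_trans (normal_word_cons_ideal j p (IHw _ p))
  (ideal_congr_sym (normal_word_move_ideal j u v)).
Qed.

Lemma wordE w : << FMonom w >> = word_coef a w *: normal_word w.
Proof. by rewrite scalerA divff ?scale1r // word_coef_neq0. Qed.

(** Sorting every word changes f into g modulo the ideal, and the coefficients of g are multiples of
    the normal coefficients of f. With [normal_coef_ideal], the ideal is thus exactly their common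
    kernel. *)
Lemma normal_coef_eq0_ideal f : (forall m, normal_coef m f = 0) -> f \in I.
Proof.
move=> f0; pose g : F := \sum_(w <- msupp f) (f@_w * word_coef a w) *:
  normal_word (word_of (content w)).
suff g0 : g = 0.
  rewrite -[f]subr0 -g0 [f in f - _]monalgE -sumrB rpred_sum // => -[w] _.
  have := ideal_scale (f@_(FMonom w) * word_coef a w)
    (normal_word_perm_ideal (perm_word_of w)).
  by rewrite scalerBr -[X in X - _ \in _]scalerA -wordE scale_word.
apply/malgP => -[v]; rewrite raddf_sum mcoeff0 /=.
(* This is 0 unless v is sorted, as g involves sorted words only. *)
pose c : k := (word_coef a (word_of (content v)))^-1 *
  (word_of (content v) == v)%:R.
transitivity (normal_coef (content v) f * c); last by rewrite f0 mul0r.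
rewrite /normal_coef mmapE mulr_suml; apply: eq_bigr => -[w] _ /=.
rewrite !mcoeffZ mcoeffU fmP /=; have [wv|wv] := eqVneq (content w) (content v).
  by rewrite wv /c /= mulr1 !mulrA.
case: eqP => [wE|_]; last by rewrite !mulr0 mul0r.
by rewrite -wE word_ofK eqxx in wv.
Qed.

Definition coef m (x : A) : k := normal_coef m (repr x).

Lemma coef_pi m f : coef m (\pi_A f) = normal_coef m f.
Proof.
rewrite /coef; apply/eqP; rewrite -subr_eq0 -raddfB; apply/eqP.
by apply: normal_coef_ideal; rewrite Quotient.idealrBE reprK.
Qed.

Lemma coef_is_additive m : zmod_morphism (coef m).
Proof.
move=> x y; rewrite -{1}[x]reprK -{1}[y]reprK -[_ - _]rmorphB coef_pi.
exact: raddfB.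
Qed.

HB.instance Definition _ m := GRing.isZmodMorphism.Build A k (coef m)
  (coef_is_additive m).

Lemma coef0 m : coef m 0 = 0.
Proof. exact: raddf0. Qed.

Lemma coef_sum m (J : finType) (x : J -> A) :
  coef m (\sum_r x r) = \sum_r coef m (x r).
Proof. exact: raddf_sum. Qed.

Lemma coef_inj x y : (forall m, coef m x = coef m y) -> x = y.
Proof.
move=> xy; rewrite -[x]reprK -[y]reprK; apply/eqP.
rewrite -Quotient.idealrBE normal_coef_eq0_ideal // => m.
by rewrite raddfB [X in X - _]xy subrr.
Qed.

Lemma coef_linforml m (v : 'rV[k]_n) (x : A) :
  coef m (\pi_A (linform v) * x) =
  \sum_(j | (0 < m j)%N) lam a j m * (v 0 j * coef (dec m j) x).
Proof.
rewrite -[x]reprK -rmorphM coef_pi mulr_suml raddf_sum [RHS]big_mkcond.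
apply: eq_bigr => j _; rewrite /= -scalerAl normal_coefZ normal_coef_genl //.
by case: ifP => _; rewrite ?mulr0 // coef_pi mulrCA.
Qed.

Lemma coef_linformr m (v : 'rV[k]_n) (x : A) :
  coef m (x * \pi_A (linform v)) =
  \sum_(j | (0 < m j)%N) lam a^T j m * (v 0 j * coef (dec m j) x).
Proof.
rewrite -[x]reprK -rmorphM coef_pi mulr_sumr raddf_sum [RHS]big_mkcond.
apply: eq_bigr => j _.
rewrite /= free_alg_scaleAr normal_coefZ normal_coef_genr //.
by case: ifP => _; rewrite ?mulr0 // coef_pi mulrCA.
Qed.

Lemma irrelevantE (x : A) : irrelevant x <-> coef mon0 x = 0.
Proof.
split=> [[f f0 ->]|x0]; first by rewrite coef_pi normal_coef_mon0.
by exists (repr x); rewrite ?reprK // -(normal_coef_mon0 a).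
Qed.

Lemma coef_surj (U : M -> k) N :
  (forall m, (N < \sum_i m i)%N -> U m = 0) ->
  exists x, forall m, coef m x = U m.
Proof.
move=> /(normal_coef_surj a_neq0) [f fU].
by exists (\pi_A f) => m; rewrite coef_pi.
Qed.

(** * Module elements and resolutions in coordinates *)

Definition coef_col s (u : 'cV[A]_s) (m : M) : 'cV[k]_s :=
  \col_r coef m (u r 0).

Lemma coef_bounded (x : A) :
  exists N, forall m, (N < \sum_i m i)%N -> coef m x = 0.
Proof. exact: (normal_coef_bounded a (repr x)). Qed.

Lemma bounded_coef_col s (u : 'cV[A]_s) : bounded (coef_col u).
Proof.
have [N uN] := fin_all_exists (fun r => coef_bounded (u r 0)).
exists (\max_r N r)%N => m mN; apply/colP => r; rewrite !mxE.
by apply: uN; apply: leq_ltn_trans mN; apply: leq_bigmax.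
Qed.

Lemma coef_col_surj s (U : M -> 'cV[k]_s) : bounded U ->
  exists u, coef_col u =1 U.
Proof.
move=> [N UN]; have ex (r : 'I_s) : exists x : A, forall m, coef m x = U m r 0.
  apply: (coef_surj (N := N)) => m mN.
  by rewrite UN ?mxE.
have [x xE] := fin_all_exists ex.
by exists (\col_r x r) => m; apply/colP => r; rewrite !mxE xE.
Qed.

Lemma coef_col_inj s (u v : 'cV[A]_s) : coef_col u =1 coef_col v -> u = v.
Proof.
move=> uv; apply/colP => r; apply: coef_inj => m.
by have /colP/(_ r) := uv m; rewrite !mxE.
Qed.

Lemma coef_col0 s : coef_col (0 : 'cV[A]_s) =1 (fun=> 0).
Proof.
by move=> m; apply/colP => r; rewrite !mxE coef0.
Qed.

Lemma coef_col_mxA s t (D : 'M['rV[k]_n]_(s, t)) (w : 'cV[A]_t) :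
  coef_col (mxA _ D *m w) =1 step a (component D) (coef_col w).
Proof.
move=> m; apply/colP => r; rewrite !mxE coef_sum summxE.
under eq_bigr => c _ do
  rewrite !mxE coef_linforml big_mkcond /=.
rewrite exchange_big [RHS]big_mkcond; apply: eq_bigr => j _ /=.
case: ifP => mj; last by rewrite big1.
rewrite !mxE mulr_sumr; apply: eq_bigr => c _.
by rewrite !mxE.
Qed.

Lemma coef_row_mxA s t (D : 'M['rV[k]_n]_(t, s)) (w : 'rV[A]_t) :
  coef_col (w *m mxA _ D)^T =1
  step a^T (fun j => (component D j)^T) (coef_col w^T).
Proof.
move=> m; apply/colP => r; rewrite !mxE coef_sum summxE.
under eq_bigr => c _ do
  rewrite !mxE coef_linformr big_mkcond /=.
rewrite exchange_big [RHS]big_mkcond; apply: eq_bigr => j _ /=.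
case: ifP => mj; last by rewrite big1.
rewrite !mxE mulr_sumr; apply: eq_bigr => c _.
by rewrite !mxE.
Qed.

Lemma irrelevant_col s (u : 'cV[A]_s) :
  (forall r, irrelevant (u r 0)) <-> coef_col u mon0 = 0.
Proof.
split=> [ur|u0 r].
  apply/colP => r; rewrite !mxE.
  exact/irrelevantE.
by apply/irrelevantE; have /colP/(_ r) := u0; rewrite !mxE.
Qed.

Lemma right_resolutionE (s : nat -> nat)
    (d : forall i : nat, 'M['rV[k]_n]_(s i.-1, s i)) :
  right_linear_resolution (skew_relations q) d <->
  model_resolution a (fun i : nat => component (d i)).
Proof.
have E := @model_resolution_transport k n a s (fun i : nat => component (d i))
  (fun i : nat => 'cV[A]_(s i)) (fun i : nat => 0)
  (fun (i : nat) v => mxA (skew_relations q) (d i.+1) *m v)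
  (fun u => forall r, irrelevant (u r 0)) (fun (i : nat) u => coef_col u)
  (fun i : nat => @bounded_coef_col (s i)) (fun i : nat => @coef_col_surj (s i))
  (fun i : nat => @coef_col_inj (s i)) (fun i : nat => @coef_col0 (s i))
  (fun (i : nat) v => coef_col_mxA (d i.+1) v) (@irrelevant_col _).
by split=> [[? ? ?]|/E [? ? ?]]; [apply/E|].
Qed.

(** Transposition turns rows into columns and right multiplication by a matrix of linear forms into
    [step] for a^T. *)
Lemma left_resolutionE (s : nat -> nat)
    (h : forall i : nat, 'M['rV[k]_n]_(s i, s i.-1)) :
  left_linear_resolution (skew_relations q) h <->
  model_resolution a^T (fun (i : nat) j => (component (h i) j)^T).
Proof.
suff E : [/\ s 0%N = 1%N,
    forall u : 'rV[A]_(s 0%N), (exists v, u = v *m mxA _ (h 1%N)) <->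
      (forall r, irrelevant (u 0 r)) &
    forall (i : nat) (u : 'rV[A]_(s i.+1)), u *m mxA _ (h i.+1) = 0 <->
      exists v, u = v *m mxA _ (h i.+2)] <->
    model_resolution a^T (fun (i : nat) j => (component (h i) j)^T).
  by split=> [[? ? ?]|/E [? ? ?]]; [apply/E|].
apply: (@model_resolution_transport k n a^T s _ (fun i : nat => 'rV[A]_(s i))
  (fun=> 0) (fun (i : nat) v => v *m mxA (skew_relations q) (h i.+1)) _
  (fun (i : nat) u => coef_col u^T)) => [i u|i U|i u v uv|i m|i v|u].
- exact: bounded_coef_col.
- by case/coef_col_surj => u uU; exists u^T; rewrite trmxK.
- by apply: trmx_inj; apply: coef_col_inj uv.
- by rewrite trmx0 coef_col0.
- exact: coef_row_mxA.
by rewrite -irrelevant_col; split=> u0 r; have := u0 r; rewrite mxE.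
Qed.

End SkewPolynomials.

(** * Points as zeros of the relations *)

Section Points.
Variables (k : fieldType) (n : nat).
Implicit Types (R : {vspace 'M[k]_n}) (y p : 'rV[k]_n) (r : 'M[k]_n).

Lemma bilinear_delta y p i j :
  (y *m delta_mx i j *m p^T) 0 0 = y 0 i * p 0 j.
Proof.
rewrite -(mul_delta_mx (0 : 'I_1)) mulmxA -colE -mulmxA -rowE.
by rewrite !mxE big_ord1 !mxE.
Qed.

Lemma bilinear_vbasis R y p :
  (forall l : 'I_(\dim R), y *m (vbasis R)`_l *m p^T = 0) ->
  forall r : 'M[k]_n, r \in R -> y *m r *m p^T = 0.
Proof.
move=> y0 r /coord_vbasis ->; rewrite mulmx_sumr mulmx_suml big1 // => l _.
by rewrite -scalemxAr -scalemxAl y0 scaler0.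
Qed.

Lemma mxrank_lt_kernel s t (E : 'M[k]_(s, t)) :
  (\rank E < s)%N -> exists2 y : 'rV[k]_s, y != 0 & y *m E = 0.
Proof.
move=> rE; have : kermx E != 0.
  by rewrite -mxrank_eq0 mxrank_ker subn_eq0 -ltnNge.
by case/rowV0Pn => y /sub_kermxP yE y0; exists y.
Qed.

(** Rank below n gives a nonzero y in the left kernel of (d_2)_p, and the entries of y (d_2)_p are
    the y F_l p^T for the basis F_l of R. *)
Lemma right_pointsP R p : right_points R p ->
  exists2 y : 'rV[k]_n, y != 0 &
    forall r : 'M[k]_n, r \in R -> y *m r *m p^T = 0.
Proof.
move=> [_ /mxrank_lt_kernel [y y0 yE]]; exists y => //.
apply: bilinear_vbasis => l; apply/matrixP => u v; rewrite [u]ord1 [v]ord1.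
have /rowP/(_ l) := yE; rewrite -mulmxA !mxE => yl.
rewrite -[RHS]yl; apply: eq_bigr => j _; rewrite !mxE; congr (_ * _).
by apply: eq_bigr => i _; rewrite !mxE.
Qed.

(** Here y comes from the right kernel of (h_2)_p, so p takes the left slot of the bilinear form. *)
Lemma left_pointsP R p : left_points R p ->
  exists2 y : 'rV[k]_n, y != 0 &
    forall r : 'M[k]_n, r \in R -> p *m r *m y^T = 0.
Proof.
move=> [_]; rewrite -mxrank_tr => /mxrank_lt_kernel [y y0 yE]; exists y => //.
apply: bilinear_vbasis => l; apply/matrixP => u v; rewrite [u]ord1 [v]ord1.
have /rowP/(_ l) := yE; rewrite !mxE => yl.
rewrite -[RHS]yl; apply: eq_bigr => j _; rewrite !mxE mulrC; congr (_ * _).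
by apply: eq_bigr => i _; rewrite !mxE mulrC.
Qed.

End Points.

(** * Point-exactness of skew polynomial algebras *)

Section SkewPointExact.
Variables (k : fieldType) (n : nat) (q a : 'M[k]_n).
Hypothesis a_neq0 : forall i j, a i j != 0.
Hypothesis a_diag : forall i, a i i = 1.
Hypothesis a_skew : forall i j, a i j = q i j * a j i.
Local Notation R := (skew_relations q).

Lemma koszul_components (b : 'M[k]_n) :
  (fun i => component (\matrix_(r, t) \row_j koszul b i j r t)) = koszul b.
Proof.
apply: functional_extensionality_dep => i; apply/funext => j.
by apply/matrixP => r t; rewrite !mxE.
Qed.

Lemma skew_right_koszul : right_koszul R.
Proof.
exists (fun i => #|level n i|),
  (fun i => \matrix_(r, t) \row_j koszul a i j r t).
apply/(right_resolutionE a_neq0 a_diag a_skew); rewrite koszul_components.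
exact: koszul_resolution.
Qed.

Lemma skew_left_koszul : left_koszul R.
Proof.
exists (fun i => #|level n i|),
  (fun i => (\matrix_(r, t) \row_j koszul a^T i j r t)^T).
apply/(left_resolutionE a_neq0 a_diag a_skew).
rewrite [X in model_resolution _ X](_ : _ = koszul a^T).
  by apply: koszul_resolution => [i j|i]; rewrite mxE.
rewrite -koszul_components; apply: functional_extensionality_dep => i.
by apply/funext => j; apply/matrixP => r t; rewrite !mxE.
Qed.

(** A relation gives y_j p_i = q_ij y_i p_j; multiplying by a_ji yields the form used in the rank
    computation. *)
Lemma skew_relation_bilinear (y p : 'rV[k]_n) i j :
    (forall r : 'M[k]_n, r \in R -> y *m r *m p^T = 0) ->
  y 0 j * p 0 i * a j i = a i j * (y 0 i * p 0 j).
Proof.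
move=> /(_ _ (skew_relation_mem q i j)); rewrite mulmxBr mulmxBl.
rewrite -scalemxAr -scalemxAl => /subr0_eq/matrixP/(_ 0 0).
by rewrite bilinear_delta => ->; rewrite mxE bilinear_delta (a_skew i j); ring.
Qed.

Lemma skew_right_point_exact i : right_point_exact R i.+1.
Proof.
move=> s d /(right_resolutionE a_neq0 a_diag a_skew) resd p pX.
have [y y0 yp] := right_pointsP pX.
rewrite !mxeval_component.
apply: (mres_point_exact a_neq0 a_diag i resd y0 pX.1).
by move=> j l; apply: skew_relation_bilinear.
Qed.

Lemma skew_left_point_exact i : left_point_exact R i.+1.
Proof.
move=> s h /(left_resolutionE a_neq0 a_diag a_skew) resh p pX.
have [y y0 yp] := left_pointsP pX.
rewrite -mxrank_tr -[X in (_ + X)%N]mxrank_tr !mxeval_component_tr.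
apply: (mres_point_exact _ _ i resh y0 pX.1) => [j l|j|j l]; rewrite !mxE //.
(* At left points y and p exchange roles, in step with the transposition of a. *)
by rewrite (mulrC (y 0 l)) (mulrC (y 0 j)); apply: skew_relation_bilinear.
Qed.

End SkewPointExact.

Theorem theorem6p4 (k : closedFieldType) (n : nat) (q : 'M[k]_n)
    (hchar : [pchar k] =i pred0) (hn : (2 <= n)%N)
    (hq_neq0 : forall i j, q i j != 0)
    (hq_diag : forall i, q i i = 1)
    (hq_inv : forall i j, q j i = (q i j)^-1) :
  point_exact_condition (skew_relations q).
Proof.
(* Below the diagonal the condition on a reads 1 = q_ij q_ji. *)
pose a : 'M[k]_n := \matrix_(i, j) if (i < j)%N then q i j else 1.
have a_neq0 i j : a i j != 0 by rewrite mxE; case: ifP; rewrite ?oner_neq0.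
have a_diag i : a i i = 1 by rewrite mxE ltnn.
have a_skew i j : a i j = q i j * a j i.
  rewrite !mxE; case: ltngtP => [||/val_inj ->]; rewrite ?mulr1 //.
    by rewrite (hq_inv i j) mulfV.
split=> [||[//|i] _].
- exact: skew_right_koszul a_neq0 a_diag a_skew.
- exact: skew_left_koszul a_neq0 a_diag a_skew.
split; first exact: (skew_right_point_exact a_neq0 a_diag a_skew).
exact: (skew_left_point_exact a_neq0 a_diag a_skew).
Qed.
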